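(* There exist absolute constants $c_0 \ge 1$ and $C \ge 1$ such that the following holds. For every $p \in [1,\infty)$, every $c \ge c_0$, all integers $d \ge 2$ and $\Delta \ge 2$, and every probability distribution $\mu$ on $[\Delta]^d = \{1,\dots,\Delta\}^d$, there exists an average-distortion sketch for $\mu$ over the metric space $([\Delta]^d, \ell_p)$ (with $d_X(x,y) = \|x-y\|_p$) with average-distortion $c$ and space complexity $s \le \left(c \cdot p \cdot 2^{p/c} \cdot \log(d\Delta)\right)^{C}$.
   Context: Let $(X,d_X)$ be a metric space and $\mu$ a probability distribution on $X$. An average-distortion sketch for $\mu$ is a probability distribution $\mathcal{D}$ over pairs $(\mathrm{sk}, \mathrm{Alg})$, where $\mathrm{sk}\colon X \to \{0,1\}^s$ is a function ($s$ is the space complexity) and $\mathrm{Alg}$ is an algorithm that takes two strings in $\{0,1\}^s$ and outputs a number in $\mathbb{R}_{\ge 0}$. It has average-distortion $c \ge 1$ if (i) (non-expansion) for all $x,y \in X$, $\mathbb{E}_{(\mathrm{sk},\mathrm{Alg})\sim\mathcal{D}}[\mathrm{Alg}(\mathrm{sk}(x),\mathrm{sk}(y))] \le d_X(x,y)$; and (ii) (bounded contraction) $\mathbb{E}_{x,y\sim\mu,\,(\mathrm{sk},\mathrm{Alg})\sim\mathcal{D}}[\mathrm{Alg}(\mathrm{sk}(x),\mathrm{sk}(y))] \ge \frac1c\,\mathbb{E}_{x,y\sim\mu}[d_X(x,y)]$, where $x$ and $y$ are drawn independently from $\mu$ (and independently of the sketch). *)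

(* Defs.v *)
From HB Require Import structures.
From mathcomp Require Import all_boot all_order all_algebra.
From mathcomp Require Import all_classical all_reals all_analysis.
From mathcomp Require Import Rstruct.
From Stdlib Require Import Rdefinitions.
Set Implicit Arguments. Unset Strict Implicit. Unset Printing Implicit Defensive.
Import Order.TTheory GRing.Theory Num.Theory.
Local Open Scope ring_scope.
Local Open Scope classical_set_scope.

(* The grid [Delta]^d; coordinates are encoded as 'I_Delta = {0,...,Delta-1},
   i.e. shifted by -1 from {1,...,Delta}, which does not change l_p distances. *)
Definition grid (d Delta : nat) : finType := {ffun 'I_d -> 'I_Delta}.

Definition lp_dist (p : R) (d Delta : nat) (x y : grid d Delta) : R :=
  powR (\sum_(i < d) powR `|((x i : nat)%:R - (y i : nat)%:R : R)| p) p^-1.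

Definition is_prob_distr (X : finType) (mu : X -> R) : Prop :=
  (forall x, 0 <= mu x) /\ \sum_(x : X) mu x = 1.

Definition bits (s : nat) := s.-tuple bool.

(* A randomized sketch given as a probability space (Omega, P) together with,
   for each outcome w, a pair (sk w, Alg w).  [is_avg_distortion_sketch] says
   that the distribution of (sk, Alg) is an average-distortion sketch for mu
   over (X, dist) with average-distortion c. *)
Definition is_avg_distortion_sketch (X : finType) (dist : X -> X -> R)
  (mu : X -> R) (c : R) (s : nat)
  (dm : measure_display) (Omega : measurableType dm) (P : probability Omega R)
  (sk : Omega -> X -> bits s) (Alg : Omega -> bits s -> bits s -> R) : Prop :=
  (forall w a b, 0 <= Alg w a b) /\
  (forall x y, measurable_fun [set: Omega]
     ((fun w => Alg w (sk w x) (sk w y)) : Omega -> (R : realType))) /\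
  (forall x y,
     (\int[P]_w (Alg w (sk w x) (sk w y))%:E <= (dist x y)%:E)%E) /\
  (* (ii) bounded contraction; x, y ~ mu independently and independently of the sketch *)
  ((c^-1 * \sum_(x : X) \sum_(y : X) mu x * mu y * dist x y)%:E <=
     \sum_(x : X) \sum_(y : X) (mu x * mu y)%:E *
        \int[P]_w (Alg w (sk w x) (sk w y))%:E)%E.

(* Main.v *)
From Stdlib Require Import Rdefinitions.
Require Import Defs.
From HB Require Import structures.
From mathcomp Require Import all_boot all_order all_algebra.
From mathcomp Require Import all_classical all_reals all_analysis.
From mathcomp Require Import Rstruct.
From mathcomp Require Import ring lra.
Set Implicit Arguments. Unset Strict Implicit. Unset Printing Implicit Defensive.
Import Order.TTheory GRing.Theory Num.Theory.
Local Open Scope ring_scope.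

(**
Centre the grid at the vector z of coordinatewise medians of mu, let
r x = |x - z|_p, and let m be the median of r.  Since E|x - y|_p <= 2 E r, it
suffices to reach E r up to the factor c.

If E|r - m| is at least (4/c) E r, the one-dimensional 1-Lipschitz map r already
has average distortion c, and a random threshold sketches it with one bit.

Otherwise r is within (1 +- delta) m with probability close to 1, for delta of
order 1/c.  A point x and an independent y lie on opposite sides of z_i with
probability at least 1/2, for every i, so for a sign-preserving monotone f the
difference |f (x_i - z_i) - f (y_i - z_i)| is then at least |f (x_i - z_i)|.

For p <= 2 the Mazur map t |-> sgn(t) |t|^p is O(m^(p-1))-Lipschitz from the
l_p-ball of radius 2m to l_1, and random cuts sketch l_1.

For p >= 2 scale the coordinates by independent u_i with P(u_i^p >= s) of order
1/s.  Then E max_i u_i |a_i| <= 3 |a|_p, while max_i u_i |a_i| >= |a|_p with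
constant probability.  Soft thresholding of u_i (x_i - z_i) at (1 - 2 delta) m is
1-Lipschitz and costs only a factor 1/delta in the answer, and it leaves
O(((1 + delta) / (1 - 2 delta))^p) = 2^O(p/c) nonzero coordinates, which are
stored explicitly.
*)

(* Without this, failing unification problems between powers unfold the
   exponential down to the definition of its power series. *)
#[local] Opaque powR expR ln.

(** * Finite sketches and their realisation on a probability space *)

Lemma ler_sum_pred (R : numDomainType) (I : finType) (P Q : pred I) (F : I -> R) :
  (forall i, 0 <= F i) -> (forall i, P i -> Q i) ->
  \sum_(i | P i) F i <= \sum_(i | Q i) F i.
Proof.
move=> F0 PQ; rewrite big_mkcond [leRHS]big_mkcond /=; apply: ler_sum => i _.
by case: ifP => [/PQ ->//|_]; case: ifP.
Qed.

(** With a finite sample space expectations are finite sums; with an arbitrary finite message type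
    [Y] bits are counted only at the end, through [#|Y| <= 2 ^ s]. *)
Definition finite_sketch (R : realType) (X Y : finType) (dist : X -> X -> R)
    (mu : X -> R) (c : R) : Prop :=
  exists (Omega : finType) (w : Omega -> R) (sk : Omega -> X -> Y)
         (Alg : Omega -> Y -> Y -> R),
  [/\ (forall o, 0 <= w o) /\ \sum_o w o = 1,
      forall o a b, 0 <= Alg o a b,
      forall x y, \sum_o w o * Alg o (sk o x) (sk o y) <= dist x y &
      c^-1 * (\sum_x \sum_y mu x * mu y * dist x y) <=
      \sum_x \sum_y mu x * mu y * \sum_o w o * Alg o (sk o x) (sk o y)].

(** The weights become point masses on [nat], whose sigma-algebra is discrete; [phi] enumerates
    [Omega], and its default value beyond [#|Omega|] carries no mass. *)
Lemma finite_probability (R : realType) (Omega : finType) (w : Omega -> R) :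
  (forall o, 0 <= w o) -> \sum_o w o = 1 ->
  exists (P : probability nat R) (phi : nat -> Omega),
  forall f : Omega -> R, (forall o, 0 <= f o) ->
    (\int[P]_n (f (phi n))%:E = (\sum_o w o * f o)%:E)%E.
Proof.
move=> w0 w1.
have /card_gt0P[e0 _] : (0 < #|Omega|)%N.
  rewrite lt0n; apply/negP => /eqP /card0_eq O0.
  by have := w1; rewrite big_pred0 // => /eqP; rewrite eq_sym oner_eq0.
pose phi n := nth e0 (enum Omega) n.
pose wn n : {nonneg R} := NngNum (w0 (phi n)).
pose m : {measure set nat -> \bar R} :=
  msum (fun n => mscale (wn n) (\d_n : {measure set nat -> \bar R})) #|Omega|.
have sumE (g : Omega -> R) : \sum_(k < #|Omega|) g (phi k) = \sum_o g o.
  rewrite (reindex (@enum_rank Omega)) /=; last first.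
    by exists enum_val => ? _; [exact: enum_rankK | exact: enum_valK].
  apply: eq_bigr => o _; congr g.
  by rewrite /phi -[in RHS](enum_rankK o) /enum_val; apply: set_nth_default;
    rewrite -cardE ltn_ord.
have mT : (m setT = 1)%E.
  rewrite /m /= /msum /=.
  under eq_bigr do rewrite /mscale /= diracT mule1.
  by rewrite sumEFin sumE w1.
pose mk : probability nat R := HB.pack (Measure.sort m)
  (Measure.class m) (Measure_isProbability.Build _ _ R m mT).
exists mk, phi => f f0.
have -> : (\int[mk]_n (f (phi n))%:E = \int[m]_n (f (phi n))%:E)%E by [].
rewrite /m ge0_integral_measure_sum //=; last by move=> n _; rewrite lee_fin.
rewrite -(sumE (fun o => w o * f o)) -sumEFin.
apply: eq_bigr => i _.
rewrite ge0_integral_mscale//=; last by move=> n _; rewrite lee_fin.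
by rewrite integral_dirac//= diracT mul1e.
Qed.

(** Messages are encoded by an injection into bit strings; on strings that encode no message the
    algorithm answers 0. *)
Lemma avg_distortion_sketch_of_finite (X Y : finType)
    (dist : X -> X -> R) (mu : X -> R) (c : R) (s : nat) :
  (#|Y| <= 2 ^ s)%N -> finite_sketch Y dist mu c ->
  exists (dm : measure_display) (Omega : measurableType dm)
         (P : probability Omega R)
         (sk : Omega -> X -> bits s) (Alg : Omega -> bits s -> bits s -> R),
    is_avg_distortion_sketch dist mu c P sk Alg.
Proof.
move=> cY [W [w [sk [Alg [[w0 w1] Alg0 ne bc]]]]].
have [P [phi Pphi]] := finite_probability w0 w1.
have cYb : (#|Y| <= #|{: bits s}|)%N by rewrite card_tuple card_bool.
pose enc (y : Y) : bits s := enum_val (widen_ord cYb (enum_rank y)).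
have enc_inj : injective enc.
  by move=> a b /enum_val_inj /(congr1 val) /= /val_inj /enum_rank_inj.
pose dec (b : bits s) : option Y := [pick y | enc y == b].
have encK y : dec (enc y) = Some y.
  rewrite /dec; case: pickP => [y' /eqP /enc_inj -> // | /(_ y)].
  by rewrite eqxx.
pose A n (a b : bits s) : R :=
  if (dec a, dec b) is (Some a', Some b') then Alg (phi n) a' b' else 0.
have AE n x y : A n (enc (sk (phi n) x)) (enc (sk (phi n) y)) =
    Alg (phi n) (sk (phi n) x) (sk (phi n) y) by rewrite /A !encK.
have intE x y : (\int[P]_n (A n (enc (sk (phi n) x)) (enc (sk (phi n) y)))%:E =
    (\sum_o w o * Alg o (sk o x) (sk o y))%:E)%E.
  rewrite -(Pphi (fun o => Alg o (sk o x) (sk o y))) //.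
  by under eq_integral do rewrite AE.
exists _, nat, P, (fun n x => enc (sk (phi n) x)), A; split; [|split; [|split]].
- by move=> n a b; rewrite /A; case: (dec a) => // ?; case: (dec b).
(* Every subset of [nat] is measurable. *)
- by move=> x y; exact: (fun _ _ _ => I).
- by move=> x y; rewrite intE lee_fin.
rewrite (eq_bigr (fun x => (\sum_y mu x * mu y *
    \sum_o w o * Alg o (sk o x) (sk o y))%:E)); first by rewrite sumEFin lee_fin.
move=> x _; rewrite -sumEFin; apply: eq_bigr => y _.
by rewrite [in RHS]EFinM -intE.
Qed.

(** * Medians *)

(** Take for [f x0] the smallest value with mass at least 1/2 at or below it. If the mass at or
    above it were under 1/2, the next smaller value would qualify too. *)
Lemma median_exists (R : realType) (X : finType) (mu f : X -> R) :
  (forall x, 0 <= mu x) -> \sum_x mu x = 1 ->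
  exists x0, 2^-1 <= \sum_(x | f x <= f x0) mu x /\
             2^-1 <= \sum_(x | f x0 <= f x) mu x.
Proof.
move=> mu0 mu1.
have /card_gt0P[e0 _] : (0 < #|X|)%N.
  rewrite lt0n; apply/negP => /eqP /card0_eq O0.
  by have := mu1; rewrite big_pred0 // => /eqP; rewrite eq_sym oner_eq0.
pose H x := 2^-1 <= \sum_(y | f y <= f x) mu y.
have Htop : H [arg max_(x > e0) f x]%O.
  case: arg_maxP => // x _ xmax; rewrite /H (eq_bigl xpredT) ?mu1; first by lra.
  by move=> y; exact: xmax.
case: (arg_minP (P := H) f Htop) => x0 Hx0 x0min; exists x0; split => //.
rewrite leNgt; apply/negP => lt2.
have split1 : \sum_(x | f x0 <= f x) mu x + \sum_(x | f x < f x0) mu x = 1.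
  rewrite -mu1 [in RHS](bigID (fun x => f x0 <= f x)) /=; congr (_ + _).
  by apply: eq_bigl => x; rewrite -ltNge.
have [x1 x1P|none] := pickP (fun x => f x < f x0); last first.
  by move: split1; rewrite [X in _ + X]big_pred0 //; lra.
case: (arg_maxP (P := fun x => f x < f x0) f x1P) => x2 x2P x2max.
have /x0min : H x2; last by rewrite leNgt x2P.
rewrite /H (eq_bigl (fun x => f x < f x0)); first by lra.
move=> y; apply/idP/idP => [yx2|]; first exact: le_lt_trans yx2 x2P.
exact: x2max.
Qed.

Definition opposite (R : realType) (m a b : R) :=
  (a <= m <= b) || (b <= m <= a).

Lemma opposite_mass (R : realType) (X : finType) (mu f : X -> R) (m a : R) :
  (forall x, 0 <= mu x) ->
  2^-1 <= \sum_(x | f x <= m) mu x -> 2^-1 <= \sum_(x | m <= f x) mu x ->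
  2^-1 <= \sum_(y | opposite m a (f y)) mu y.
Proof.
move=> mu0 lo hi; have [am|ma] := leP a m.
  apply: (le_trans hi); apply: ler_sum_pred => // y my.
  by rewrite /opposite am my.
apply: (le_trans lo); apply: ler_sum_pred => // y my.
by rewrite /opposite my (ltW ma) orbT.
Qed.

(** For fixed [x], the value [f y] lies across the median with mass at least 1/2, and then |f x - f
    y| >= |f x - m|. *)
Lemma mean_abs_diff_ge (R : realType) (X : finType) (mu f : X -> R) (m : R) :
  (forall x, 0 <= mu x) ->
  2^-1 <= \sum_(x | f x <= m) mu x -> 2^-1 <= \sum_(x | m <= f x) mu x ->
  2^-1 * (\sum_x mu x * `|f x - m|) <=
  \sum_x \sum_y mu x * mu y * `|f x - f y|.
Proof.
move=> mu0 lo hi; rewrite mulr_sumr; apply: ler_sum => x _.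
under eq_bigr do rewrite -mulrA.
rewrite -mulr_sumr mulrCA ler_wpM2l //.
apply: (@le_trans _ _ ((\sum_(y | opposite m (f x) (f y)) mu y) * `|f x - m|)).
  by rewrite ler_wpM2r // (opposite_mass (f x) mu0 lo hi).
rewrite mulr_suml big_mkcond /=; apply: ler_sum => y _.
case: ifP => [opp|_]; last by rewrite mulr_ge0.
rewrite ler_wpM2l //.
case/orP: opp => /andP[? ?]; last by rewrite !ger0_norm; lra.
by rewrite distrC [leRHS]distrC !ger0_norm; lra.
Qed.

(** * Random thresholds *)

(** A finite metric on the line is a sum of cuts: threshold [k] is weighted by a gap between
    consecutive sorted values, and the gaps between [f x] and [f y] telescope. *)
Lemma threshold_weights (R : realType) (X : finType) (f : X -> R) :
  exists (w : 'I_#|X| -> R) (h : 'I_#|X| -> X -> bool),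
  (forall k, 0 <= w k) /\
  forall x y, \sum_k w k * (h k x != h k y)%:R = `|f x - f y|.
Proof.
pose s := sort <=%R [seq f x | x <- enum X].
have ss : size s = #|X| by rewrite size_sort size_map -cardE.
have so : sorted <=%R s by apply: sort_sorted; exact: le_total.
(* For the last [k] the upper end of the gap is the default value 0, hence the absolute value; as
   [j x < #|X|], no [x] passes that threshold. *)
pose w (k : nat) := `|s`_k.+1 - s`_k|.
pose j x := index (f x) s.
have fs x : f x \in s by rewrite mem_sort map_f // mem_enum.
have js x : (j x < #|X|)%N by rewrite -ss index_mem.
have sj x : s`_(j x) = f x by rewrite nth_index.
exists (fun k => w k), (fun k x => (k < j x)%N); split => [k|x y].
  exact: normr_ge0.
wlog xy : x y / f x <= f y.
  move=> H; have [/H//|/ltW /H] := leP (f x) (f y).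
  by rewrite distrC => <-; apply: eq_bigr => k _; rewrite eq_sym.
have jxy : (j x <= j y)%N.
  rewrite leqNgt; apply/negP => yx.
  have : f y <= f x.
    rewrite -(sj x) -(sj y).
    by apply: (sorted_ltn_nth le_trans 0 so) => //; rewrite inE ss.
  by move=> fyx; move: yx; rewrite /j (@le_anti _ _ (f x) (f y)) ?xy ?ltnn.
have -> : \sum_(k < #|X|) w k * ((k < j x)%N != (k < j y)%N)%:R =
    \sum_(j x <= k < j y) (s`_k.+1 - s`_k).
  rewrite -(big_mkord xpredT (fun k => w k * ((k < j x)%N != (k < j y)%N)%:R)).
  rewrite (big_cat_nat (leq0n (j x)) (leq_trans jxy (ltnW (js y)))) /=.
  rewrite big_nat big1 ?add0r; last first.
    by move=> k /andP[_ kx]; rewrite kx (leq_trans kx jxy) mulr0.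
  rewrite (big_cat_nat jxy (ltnW (js y))) /=.
  rewrite [X in _ + X]big_nat [X in _ + X]big1 ?addr0; last first.
    move=> k /andP[yk _].
    by rewrite !ltnNge yk (leq_trans jxy yk) mulr0.
  rewrite !big_nat; apply: eq_bigr => k /andP[xk ky].
  rewrite ky ltnNge xk /= mulr1 /w ger0_norm // subr_ge0.
  have ks : (k.+1 < size s)%N by rewrite ss (leq_ltn_trans ky).
  by apply: (sorted_ltn_nth le_trans 0 so) => //; rewrite inE // ltnW.
by rewrite telescope_sumr // !sj distrC ger0_norm // subr_ge0.
Qed.

(** Sample a coordinate and a threshold with probability proportional to the weight; the message is
    the flag [g x] and the side of the threshold. Answering the total weight [W] when both flags are
    set and the sides differ has the truncated l_1 distance as its exact expectation. *)
Lemma l1_sketch (R : realType) (X I : finType) (F : X -> I -> R) (g : pred X)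
    (dist : X -> X -> R) (mu : X -> R) (c : R) :
  (forall x y, 0 <= dist x y) ->
  (forall x y, g x -> g y -> \sum_i `|F x i - F y i| <= dist x y) ->
  c^-1 * (\sum_x \sum_y mu x * mu y * dist x y) <=
    \sum_x \sum_y mu x * mu y *
      (if g x && g y then \sum_i `|F x i - F y i| else 0) ->
  finite_sketch (bool * bool)%type dist mu c.
Proof.
move=> dist0 ne bc.
have /choice[w wP] (i : I) := threshold_weights (F ^~ i).
have {wP} /choice[h whP] := wP.
pose W := \sum_i \sum_k w i k.
have W0 : 0 <= W by apply: sumr_ge0 => i _; apply: sumr_ge0 => k _; case: (whP i).
pose D x y := if g x && g y then \sum_i `|F x i - F y i| else 0.
have D0 x y : 0 <= D x y by rewrite /D; case: ifP => // _; apply: sumr_ge0.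
have neD x y : D x y <= dist x y.
  by rewrite /D; case: ifP => // /andP[gx gy]; exact: ne.
suff [Om [v [sk [Alg [v01 Alg0 AlgE]]]]] : exists (Om : finType) (v : Om -> R)
    (sk : Om -> X -> bool * bool) (Alg : Om -> bool * bool -> bool * bool -> R),
    [/\ (forall o, 0 <= v o) /\ \sum_o v o = 1,
        forall o a b, 0 <= Alg o a b &
        forall x y, \sum_o v o * Alg o (sk o x) (sk o y) = D x y].
  exists Om, v, sk, Alg; split => // [x y|]; first by rewrite AlgE.
  apply: (le_trans bc); rewrite le_eqVlt; apply/orP; left; apply/eqP.
  by apply: eq_bigr => x _; apply: eq_bigr => y _; rewrite AlgE.
have DE x y : \sum_(q : I * 'I_#|X|) w q.1 q.2 *
    (if g x && g y then (h q.1 q.2 x != h q.1 q.2 y)%:R else 0) = D x y.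
  rewrite -(pair_bigA _ (fun i k => w i k *
    (if g x && g y then (h i k x != h i k y)%:R else 0))) /= /D.
  case: ifP => _; last by apply: big1 => i _; apply: big1 => k _; rewrite mulr0.
  by apply: eq_bigr => i _; case: (whP i) => _ <-.
(* If there is no weight to normalise, [D] vanishes identically and the answer 0 is exact. *)
have [W00|Wn0] := eqVneq W 0.
  exists unit, (fun=> 1), (fun _ _ => (true, true)), (fun _ _ _ => 0); split => //.
    by split=> //; rewrite big_const card_unit /= addr0.
  move=> x y; rewrite big1 // => [|? _]; last by rewrite mulr0.
  apply/esym; rewrite -DE big1 // => -[i k] _ /=.
  suff -> : w i k = 0 by rewrite mul0r.
  have := W00; rewrite /W pair_bigA /= => /eqP.
  rewrite psumr_eq0; last by move=> [a b] _ /=; case: (whP a).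
  by move=> /allP /(_ (i, k)); rewrite mem_index_enum /= => /(_ isT) /eqP.
exists (I * 'I_#|X|)%type, (fun q => w q.1 q.2 / W),
  (fun q x => (g x, h q.1 q.2 x)),
  (fun _ a b => if a.1 && b.1 then W * (a.2 != b.2)%:R else 0); split.
- split; first by move=> [i k] /=; rewrite divr_ge0 //; case: (whP i).
  by rewrite -mulr_suml -(pair_bigA _ w) divff.
- by move=> q a b; case: ifP => // _; rewrite mulr_ge0.
move=> x y; rewrite -DE; apply: eq_bigr => q _ /=.
by case: ifP => _; rewrite ?mulr0 // mulrA divfK.
Qed.

(** * The l_p norm *)

Lemma ge0_ler_powR2 (R : realType) (p a b : R) : 0 < p -> 0 <= a -> 0 <= b ->
  (a `^ p <= b `^ p) = (a <= b).
Proof.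
move=> p0 a0 b0; apply/idP/idP => [|ab]; last first.
  by rewrite ge0_ler_powR // ?nnegrE // ltW.
apply: contraTT; rewrite -!ltNge => ba.
by rewrite gt0_ltr_powR // nnegrE.
Qed.

Lemma powRKV (R : realType) (p a : R) : 0 < p -> 0 <= a -> (a `^ p^-1) `^ p = a.
Proof. by move=> p0 a0; rewrite -powRrM mulVf ?gt_eqF // powRr1. Qed.

Lemma powRVK (R : realType) (p a : R) : 0 < p -> 0 <= a -> (a `^ p) `^ p^-1 = a.
Proof. by move=> p0 a0; rewrite -powRrM mulfV ?gt_eqF // powRr1. Qed.

Lemma powR_convex (R : realType) (p t a b : R) :
  1 <= p -> 0 <= t -> t <= 1 -> 0 <= a -> 0 <= b ->
  (t * a + (1 - t) * b) `^ p <= t * a `^ p + (1 - t) * b `^ p.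
Proof.
move=> p1 t0 t1 a0 b0.
have := @convex_powR R p p1 (Itv01 t0 t1) a b.
by rewrite !inE /= !in_itv /= !andbT => /(_ a0 b0); rewrite !convRE.
Qed.

HB.lock Definition pnorm (R : realType) (I : finType) (p : R) (v : I -> R) : R :=
  (\sum_i `|v i| `^ p) `^ p^-1.

Lemma pnorm_ge0 (R : realType) (I : finType) (p : R) (v : I -> R) :
  0 <= pnorm p v.
Proof. by rewrite pnorm.unlock; exact: powR_ge0. Qed.

Lemma pnorm_powR (R : realType) (I : finType) (p : R) (v : I -> R) :
  0 < p -> pnorm p v `^ p = \sum_i `|v i| `^ p.
Proof. by move=> p0; rewrite pnorm.unlock powRKV // sumr_ge0 // => i _; exact: powR_ge0. Qed.

Lemma pnorm_eq0 (R : realType) (I : finType) (p : R) (v : I -> R) (i : I) :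
  0 < p -> pnorm p v = 0 -> v i = 0.
Proof.
rewrite pnorm.unlock => p0 /powR_eq0_eq0 /eqP; rewrite psumr_eq0; last by move=> *; exact: powR_ge0.
move=> /allP /(_ i); rewrite mem_index_enum => /(_ isT) /= /eqP /powR_eq0_eq0 /eqP.
by rewrite normr_eq0 => /eqP.
Qed.

Lemma eq_pnorm_abs (R : realType) (I : finType) (p : R) (v w : I -> R) :
  (forall i, `|v i| = `|w i|) -> pnorm p v = pnorm p w.
Proof.
rewrite pnorm.unlock.
by move=> vw; congr (_ `^ _); apply: eq_bigr => i _; rewrite vw.
Qed.

(** Minkowski's inequality: with A and B the two norms, (v + w) / (A + B) is the convex combination
    of v / A and w / B with weight t = A / (A + B), and convexity of the p-th power applies
    coordinatewise. *)
Lemma pnormD (R : realType) (I : finType) (p : R) (v w : I -> R) :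
  1 <= p -> pnorm p (fun i => v i + w i) <= pnorm p v + pnorm p w.
Proof.
move=> p1; have p0 : 0 < p by exact: lt_le_trans p1.
have [A0|An0] := eqVneq (pnorm p v) 0.
  rewrite A0 add0r (eq_pnorm_abs p (w := w)) // => i.
  by rewrite (pnorm_eq0 i p0 A0) add0r.
have [B0|Bn0] := eqVneq (pnorm p w) 0.
  rewrite B0 addr0 (eq_pnorm_abs p (w := v)) // => i.
  by rewrite (pnorm_eq0 i p0 B0) addr0.
have A0 : 0 < pnorm p v by rewrite lt0r An0 pnorm_ge0.
have B0 : 0 < pnorm p w by rewrite lt0r Bn0 pnorm_ge0.
have [A AE] : exists A, A = pnorm p v by exists (pnorm p v).
have [B BE] : exists B, B = pnorm p w by exists (pnorm p w).
rewrite -AE in A0 An0 *; rewrite -BE in B0 Bn0 *.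
have S0 : 0 < A + B by exact: addr_gt0.
have := ge0_ler_powR2 p0 (pnorm_ge0 p (fun i => v i + w i)) (ltW S0).
move=> <-; rewrite pnorm_powR //.
have [t [t0 t1 At Bt]] : exists t, [/\ 0 <= t, t <= 1,
    (A + B) * t / A = 1 & (A + B) * (1 - t) / B = 1].
  exists (A / (A + B)); split.
  - by apply: divr_ge0; exact: ltW.
  - by rewrite ler_pdivrMr // mul1r lerDl ltW.
  - by field; rewrite An0 gt_eqF.
  - by field; rewrite Bn0 gt_eqF.
apply: (@le_trans _ _ (\sum_i (A + B) `^ p *
    (t * (`|v i| / A) `^ p + (1 - t) * (`|w i| / B) `^ p))).
  apply: ler_sum => i _.
  apply: (@le_trans _ _ ((A + B) `^ p *
     (t * (`|v i| / A) + (1 - t) * (`|w i| / B)) `^ p)); last first.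
    apply: ler_wpM2l; first exact: powR_ge0.
    by apply: powR_convex => //; apply: divr_ge0 => //; exact: ltW.
  have n1 : 0 <= `|v i| := normr_ge0 _. have n2 : 0 <= `|w i| := normr_ge0 _.
  rewrite -powRM; [|exact: ltW|]; last first.
    by apply: addr_ge0; apply: mulr_ge0; rewrite ?subr_ge0 //; apply: divr_ge0 => //; exact: ltW.
  have -> : (A + B) * (t * (`|v i| / A) + (1 - t) * (`|w i| / B)) =
    ((A + B) * t / A) * `|v i| + ((A + B) * (1 - t) / B) * `|w i| by ring.
  rewrite At Bt !mul1r.
  by rewrite ge0_ler_powR2 ?ler_normD //; exact: addr_ge0.
rewrite -mulr_sumr big_split /= -!mulr_sumr.
have E (u : I -> R) C : 0 < C -> C = pnorm p u ->
    \sum_i (`|u i| / C) `^ p = 1.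
  move=> C0 CE.
  under eq_bigr do rewrite powRM ?normr_ge0 ?invr_ge0 ?(ltW C0) //.
  rewrite -mulr_suml -pnorm_powR // -CE -powRM ?invr_ge0 ?(ltW C0) //.
  by rewrite mulfV ?gt_eqF // powR1.
by rewrite (E v A) // (E w B) // !mulr1 subrKC mulr1.
Qed.

(** * The distance to a centre: radial sketch and mean distance *)

Lemma radial_sketch (R : realType) (X : finType) (dist : X -> X -> R)
    (mu r : X -> R) (m c : R) :
  (forall x, 0 <= mu x) ->
  (forall x y, `|r x - r y| <= dist x y) ->
  2^-1 <= \sum_(x | r x <= m) mu x -> 2^-1 <= \sum_(x | m <= r x) mu x ->
  c^-1 * (\sum_x \sum_y mu x * mu y * dist x y) <=
    2^-1 * (\sum_x mu x * `|r x - m|) ->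
  finite_sketch (bool * bool)%type dist mu c.
Proof.
move=> mu0 lip lo hi bc.
apply: (@l1_sketch R X 'I_1 (fun x _ => r x) xpredT) => [x y|x y _ _|].
- exact: le_trans (lip x y).
- by rewrite big_ord1.
apply: (le_trans bc).
under [leRHS]eq_bigr do under eq_bigr do rewrite big_ord1 /=.
exact: mean_abs_diff_ge.
Qed.

Lemma mean_dist_le (R : realType) (X : finType) (dist : X -> X -> R)
    (mu r : X -> R) :
  (forall x, 0 <= mu x) -> \sum_x mu x = 1 ->
  (forall x y, dist x y <= r x + r y) ->
  \sum_x \sum_y mu x * mu y * dist x y <= 2 * \sum_x mu x * r x.
Proof.
move=> mu0 mu1 tri.
apply: (@le_trans _ _ (\sum_x \sum_y (mu y * (mu x * r x) + mu x * (mu y * r y)))).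
  apply: ler_sum => x _; apply: ler_sum => y _.
  have -> : mu y * (mu x * r x) + mu x * (mu y * r y) = mu x * mu y * (r x + r y).
    by ring.
  by rewrite ler_wpM2l // mulr_ge0.
under eq_bigr => x _ do rewrite big_split /= -mulr_suml mu1 mul1r -mulr_sumr.
by rewrite big_split /= -mulr_suml mu1 mul1r mulr_natl mulr2n.
Qed.

(** * The case p <= 2 *)

(* The Mazur map from l_p to l_1, coordinatewise. *)
Definition signed_powR (R : realType) (p a : R) : R :=
  if 0 <= a then `|a| `^ p else - (`|a| `^ p).

(** Since t / s <= 1 and p - 1 <= 1, t s^(p-1) <= s t^(p-1). Hence s (s^p - t^p) <= (s^2 - t^2)
    s^(p-1), and s + t <= 2 s. *)
Lemma powR_diff_le (R : realType) (p s t : R) : 1 <= p -> p <= 2 ->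
  0 <= t -> t <= s -> s `^ p - t `^ p <= 2 * (s - t) * s `^ (p - 1).
Proof.
move=> p1 p2 t0 ts.
have p0 : 0 < p by exact: lt_le_trans p1.
have s0 : 0 <= s by exact: le_trans ts.
have S0 : 0 <= s `^ (p - 1) by exact: powR_ge0.
rewrite -(mulr_powRB1 s0 p0) -(mulr_powRB1 t0 p0).
have [->|tn0] := eqVneq t 0; first by rewrite mul0r !subr0; nra.
have t_gt0 : 0 < t by rewrite lt0r tn0.
have s_gt0 : 0 < s by exact: lt_le_trans ts.
have tST : t * s `^ (p - 1) <= s * t `^ (p - 1).
  have q1 : 0 < t / s <= 1 by rewrite divr_gt0 //= ler_pdivrMr // mul1r.
  have := @ger1_powR R (t / s) (p - 1) q1; rewrite lerBlDr => /(_ p2).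
  have -> : (t / s) `^ (p - 1) = t `^ (p - 1) / s `^ (p - 1).
    rewrite powRM ?invr_ge0 //; congr (_ * _).
    by rewrite -(powR_inv1 s0) powRAC powR_inv1 ?powR_ge0.
  rewrite ler_pdivrMr // mulrAC ler_pdivlMr ?powR_gt0 // => h.
  by rewrite [leRHS]mulrC.
move: (s `^ (p - 1)) (t `^ (p - 1)) S0 tST => S T S0 tST.
have h1 := ler_wpM2l t0 tST.
have h2 : 0 <= S * (s - t) ^+ 2 by rewrite mulr_ge0 ?sqr_ge0.
by rewrite -(ler_pM2l s_gt0); lra.
Qed.

(** For equal signs this is [powR_diff_le]; for opposite signs |a - b| = |a| + |b|, and a^p = a
    a^(p-1) suffices. *)
Lemma signed_powR_diff_le (R : realType) (p a b : R) : 1 <= p -> p <= 2 ->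
  `|signed_powR p a - signed_powR p b| <=
  2 * `|a - b| * (`|a| `^ (p - 1) + `|b| `^ (p - 1)).
Proof.
move=> p1 p2.
have p0 : 0 < p by exact: lt_le_trans p1.
have same s t : 0 <= s -> 0 <= t -> `|s `^ p - t `^ p| <=
    2 * `|s - t| * (s `^ (p - 1) + t `^ (p - 1)).
  move=> s0 t0; wlog ts : s t s0 t0 / t <= s.
    move=> H; have [|/ltW] := leP t s; first exact: H.
    move=> st; rewrite distrC [`|s - t|]distrC [X in _ * X]addrC; exact: H.
  have T0 : 0 <= t `^ (p - 1) by exact: powR_ge0.
  rewrite !ger0_norm ?subr_ge0 //; last by rewrite ge0_ler_powR2.
  apply: (le_trans (powR_diff_le p1 p2 t0 ts)).
  by rewrite ler_wpM2l ?lerDl // mulr_ge0 ?subr_ge0.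
have diff s t : 0 <= s -> 0 <= t -> s `^ p + t `^ p <=
    2 * (s + t) * (s `^ (p - 1) + t `^ (p - 1)).
  move=> s0 t0; rewrite -(mulr_powRB1 s0 p0) -(mulr_powRB1 t0 p0).
  have := powR_ge0 s (p - 1); have := powR_ge0 t (p - 1).
  move: (s `^ (p - 1)) (t `^ (p - 1)) => S T T0 S0.
  have sT := mulr_ge0 s0 T0; have tS := mulr_ge0 t0 S0.
  have sS := mulr_ge0 s0 S0; have tT := mulr_ge0 t0 T0.
  lra.
rewrite /signed_powR.
have [a0|a0] := leP 0 a; have [b0|b0] := leP 0 b.
- by rewrite (ger0_norm a0) (ger0_norm b0); exact: same.
- rewrite opprK ger0_norm ?addr_ge0 ?powR_ge0 //.
  have -> : `|a - b| = `|a| + `|b|.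
    by rewrite (ger0_norm a0) (ltr0_norm b0) ger0_norm; lra.
  exact: diff.
- rewrite -opprD normrN ger0_norm ?addr_ge0 ?powR_ge0 //.
  have -> : `|a - b| = `|a| + `|b|.
    by rewrite distrC (ger0_norm b0) (ltr0_norm a0) ger0_norm; lra.
  exact: diff.
- rewrite opprK addrC.
  have -> : `|a - b| = `| `|b| - `|a| |.
    by rewrite (ltr0_norm b0) (ltr0_norm a0); congr (`|_|); lra.
  by rewrite [_ + `|b| `^ _]addrC; exact: same.
Qed.

(* Hoelder's inequality up to a factor 2, from a b^(p-1) <= a^p + b^p. *)
Lemma sum_mul_powR_le (R : realType) (I : finType) (p B : R) (u v : I -> R) :
  1 <= p -> 0 < B -> pnorm p v <= B ->
  \sum_i `|u i| * `|v i| `^ (p - 1) <= 2 * pnorm p u * B `^ (p - 1).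
Proof.
move=> p1 B0 vB.
have p0 : 0 < p by exact: lt_le_trans p1.
have [U0|Un0] := eqVneq (pnorm p u) 0.
  rewrite U0 mulr0 mul0r big1 // => i _.
  by rewrite (pnorm_eq0 i p0 U0) normr0 mul0r.
have U0 : 0 < pnorm p u by rewrite lt0r Un0 pnorm_ge0.
have [U UE] : exists U, U = pnorm p u by exists (pnorm p u).
rewrite -UE in U0 Un0 *.
have young a b : 0 <= a -> 0 <= b -> a * b `^ (p - 1) <= a `^ p + b `^ p.
  move=> a0 b0; have [ab|/ltW ba] := leP a b.
    rewrite -[leLHS]add0r lerD ?powR_ge0 // -(mulr_powRB1 b0 p0).
    by rewrite ler_wpM2r ?powR_ge0.
  rewrite -[leLHS]addr0 lerD ?powR_ge0 // -(mulr_powRB1 a0 p0) ler_wpM2l //.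
  by rewrite ge0_ler_powR // ?nnegrE // subr_ge0.
(* Normalising by [U] and [B] makes both sums of p-th powers at most 1. *)
have term i : `|u i| * `|v i| `^ (p - 1) <=
    U * B `^ (p - 1) * ((`|u i| / U) `^ p + (`|v i| / B) `^ p).
  apply: (@le_trans _ _ (U * B `^ (p - 1) * ((`|u i| / U) * (`|v i| / B) `^ (p - 1)))).
    rewrite mulrACA -powRM ?divr_ge0 ?(ltW B0) // [U * _]mulrC [B * _]mulrC.
    by rewrite !divfK ?gt_eqF.
  rewrite ler_wpM2l ?mulr_ge0 ?powR_ge0 ?(ltW U0) //.
  by apply: young; rewrite divr_ge0 // ltW.
apply: (le_trans (ler_sum _ (fun i _ => term i))).
rewrite -mulr_sumr big_split /=.
have -> : 2 * U * B `^ (p - 1) = U * B `^ (p - 1) * 2 by ring.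
rewrite ler_wpM2l ?mulr_ge0 ?powR_ge0 ?(ltW U0) //.
have E C (w : I -> R) : 0 < C -> pnorm p w <= C -> \sum_i (`|w i| / C) `^ p <= 1.
  move=> C0 wC.
  under eq_bigr do rewrite powRM ?normr_ge0 ?invr_ge0 ?(ltW C0) //.
  rewrite -mulr_suml -pnorm_powR // -powRM ?invr_ge0 ?(ltW C0) ?pnorm_ge0 //.
  apply: (@le_trans _ _ (1 `^ p)); last by rewrite powR1.
  rewrite ge0_ler_powR2 ?divr_ge0 ?pnorm_ge0 ?(ltW C0) //.
  by rewrite ler_pdivrMr // mul1r.
by rewrite (_ : 2 = 1 + 1) // lerD // E // UE.
Qed.

(* Outside the annulus g the Mazur map is not Lipschitz; there the sketch
   reports a failure and Alg answers 0, which keeps it non-expanding. *)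
Lemma mazur_sketch (R : realType) (X I : finType) (v : X -> I -> R)
    (mu : X -> R) (g : pred X) (p m c : R) :
  let dist x y := pnorm p (fun i => v x i - v y i) in
  1 <= p -> p <= 2 -> 0 < m -> 10 * 100 <= c ->
  (forall x, 0 <= mu x) -> \sum_x mu x = 1 ->
  (forall i, 2^-1 <= \sum_(x | v x i <= 0) mu x) ->
  (forall i, 2^-1 <= \sum_(x | 0 <= v x i) mu x) ->
  (forall x, g x -> m / 2 <= pnorm p (v x) <= 2 * m) ->
  \sum_(x | ~~ g x) mu x <= 100^-1 ->
  \sum_x \sum_y mu x * mu y * dist x y <= 3 * m ->
  finite_sketch (bool * bool)%type dist mu c.
Proof.
move=> dist p1 p2 m0 c1 mu0 mu1 lo hi gP bad avg.
have p0 : 0 < p by exact: lt_le_trans p1.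
have m20 : 0 < 2 * m by rewrite mulr_gt0.
(* The Lipschitz constant on the ball of radius 2 m: a factor 2 from [signed_powR_diff_le], and a
   factor 2 from the Hoelder bound for each of its two terms. *)
pose K := 8 * (2 * m) `^ (p - 1).
have K0 : 0 < K by rewrite mulr_gt0 // powR_gt0.
pose F x i := signed_powR p (v x i) / K.
have FB x y i : `|F x i - F y i| = `|signed_powR p (v x i) - signed_powR p (v y i)| / K.
  by rewrite /F -mulrBl normrM (gtr0_norm (x := K^-1)) ?invr_gt0.
apply: (@l1_sketch R X I F g) => [x y|x y gx gy|].
- exact: pnorm_ge0.
- under eq_bigr do rewrite FB.
  rewrite -mulr_suml ler_pdivrMr //.
  apply: (le_trans (ler_sum _ (fun i _ => signed_powR_diff_le (v x i) (v y i) p1 p2))).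
  under eq_bigr do rewrite mulrDr -!mulrA.
  rewrite big_split /= -!mulr_sumr.
  have /andP[_ rx] := gP x gx; have /andP[_ ry] := gP y gy.
  have hx := sum_mul_powR_le (fun i => v x i - v y i) p1 m20 rx.
  have hy := sum_mul_powR_le (fun i => v x i - v y i) p1 m20 ry.
  rewrite /K /dist; move: hx hy.
  move: (\sum_i _) (\sum_i _) (pnorm p _) ((2 * m) `^ _) => a b P Q.
  lra.
have good : 99 / 100 <= \sum_(x | g x) mu x.
  by move: mu1; rewrite (bigID g) /=; lra.
(* For [x] in [g], |F x|_1 >= (m / 2)^p / K >= m^p / (4 K), at least m / 64 since K <= 16 m^(p-1).
   The [y] across a coordinate median contribute the factor 49/100. *)
apply: (@le_trans _ _ (\sum_(x | g x) mu x * (49 / 100 * (m * m `^ (p - 1) / 4 / K)))).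
  rewrite -mulr_suml.
  have KE : K <= 16 * m `^ (p - 1).
    rewrite /K powRM // ?(ltW m0) //.
    have h : 2 `^ (p - 1) <= 2 :> R.
      rewrite -[leRHS]powRr1 // ler_powR //; first by lra.
      by rewrite lerBlDr.
    have := powR_ge0 m (p - 1); move: (m `^ _) (2 `^ _) h => M T h M0; nra.
  have h1 : 64^-1 * m <= m * m `^ (p - 1) / 4 / K.
    rewrite ler_pdivlMr //; have := ler_wpM2l (ltW m0) KE.
    by move: (m `^ (p - 1)) => M; lra.
  move: h1; move: (m * _ / 4 / K) => Q h1.
  move: avg good; move: (\sum_x \sum_y _) (\sum_(x | g x) _) => S G avg good.
  have ci : c^-1 <= (10 * 100)^-1 by rewrite lef_pV2 // ?posrE; lra.
  have c0 : 0 <= c^-1 by rewrite invr_ge0; lra.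
  apply: (@le_trans _ _ ((10 * 100)^-1 * (3 * m))).
    apply: (@le_trans _ _ (c^-1 * (3 * m))); first by rewrite ler_wpM2l.
    by rewrite ler_wpM2r //; lra.
  have : 99 / 100 * (49 / 100 * (64^-1 * m)) <= G * (49 / 100 * Q).
    by apply: ler_pM; lra.
  lra.
rewrite [leRHS](bigID g) /= -[leLHS]addr0; apply: lerD; last first.
  apply: sumr_ge0 => x _; apply: sumr_ge0 => y _; rewrite mulr_ge0 ?mulr_ge0 //.
  by case: ifP => // _; exact: sumr_ge0.
apply: ler_sum => x gx.
under [leRHS]eq_bigr do rewrite -mulrA.
rewrite -mulr_sumr ler_wpM2l //.
(* The median gives 1/2, and the [y] outside [g] cost at most 1/100. *)
have half i : 49 / 100 <= \sum_(y | g y && opposite 0 (v x i) (v y i)) mu y.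
  have h := opposite_mass (v x i) mu0 (lo i) (hi i).
  have : \sum_(y | opposite 0 (v x i) (v y i)) mu y <=
      \sum_(y | g y && opposite 0 (v x i) (v y i)) mu y + \sum_(y | ~~ g y) mu y.
    rewrite [leLHS](bigID g) /=; apply: lerD.
      by apply: ler_sum_pred => // y /andP[-> ->].
    by apply: ler_sum_pred => // y /andP[].
  lra.
apply: (@le_trans _ _ (\sum_i \sum_y
    if g y && opposite 0 (v x i) (v y i) then mu y * (`|v x i| `^ p / K) else 0)).
  apply: (@le_trans _ _ (\sum_i 49 / 100 * (`|v x i| `^ p / K))); last first.
    apply: ler_sum => i _; rewrite -big_mkcond -mulr_suml ler_wpM2r //.
    by rewrite divr_ge0 ?powR_ge0 // ltW.
  rewrite -mulr_sumr -mulr_suml -pnorm_powR // ler_wpM2l //.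
  rewrite ler_wpM2r ?invr_ge0 ?(ltW K0) //.
  have /andP[r1 _] := gP x gx.
  apply: (@le_trans _ _ ((m / 2) `^ p)); last first.
    by rewrite ge0_ler_powR2 ?pnorm_ge0 // divr_ge0 // ltW.
  rewrite powRM ?(ltW m0) // -(mulr_powRB1 (ltW m0) p0).
  rewrite ler_wpM2l ?mulr_ge0 ?powR_ge0 ?(ltW m0) //.
  rewrite (_ : 4^-1 = 2^-1 `^ 2); last by rewrite powR_mulrn //; lra.
  by apply: ger_powR => //; lra.
rewrite exchange_big /=; apply: ler_sum => y _; rewrite gx /=.
case: (boolP (g y)) => gy /=; last by rewrite big1 ?mulr0.
rewrite mulr_sumr; apply: ler_sum => i _; case: ifP => [opp|_]; last first.
  by rewrite mulr_ge0.
rewrite ler_wpM2l // FB ler_wpM2r ?invr_ge0 ?(ltW K0) //.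
have pw0 b : 0 <= `|b| `^ p by exact: powR_ge0.
(* [signed_powR] counts 0 as nonnegative, so a zero coordinate is treated apart. *)
rewrite /signed_powR; case/orP: opp => /andP[].
  rewrite le_eqVlt => /predU1P[->|xi]; first by rewrite normr0 powR0 ?gt_eqF.
  move=> ->; rewrite (lt_geF xi) /= -opprD normrN.
  by apply: le_trans (ler_norm _); rewrite lerDl.
move=> yi ->; apply: le_trans (ler_norm _).
have [yi0|yi0] := leP 0 (v y i); last by rewrite opprK lerDl.
have -> : v y i = 0 by apply/le_anti; rewrite yi yi0.
by rewrite normr0 powR0 ?gt_eqF // subr0.
Qed.

(** * Independent random scalings *)

(** The terms up to [t] form a geometric progression of ratio at most 1/2. In the induction a
    leading term above [t] drops out and [t] is rescaled to [t / q]. *)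
Lemma geometric_tail_le (R : realType) (q t : R) (n : nat) :
  0 < q -> q <= 2^-1 -> 0 <= t ->
  \sum_(k < n) (if q ^+ k <= t then q ^+ k else 0) <= 2 * t.
Proof.
move=> q0 q2; elim: n t => [|n IH] t t0; first by rewrite big_ord0 mulr_ge0.
rewrite big_ord_recl expr0.
have [t1|t1] := leP 1 t.
  have := IH 1 ler01.
  have q1 k : q ^+ k <= 1 by apply: exprn_ile1; lra.
  under eq_bigr do rewrite q1.
  move=> h; apply: (@le_trans _ _ (1 + q * (\sum_(k < n) q ^+ k))).
    rewrite lerD2l mulr_sumr; apply: ler_sum => k _; rewrite /= exprS.
    by case: ifP => // _; rewrite mulr_ge0 ?exprn_ge0 // ltW.
  have : q * (\sum_(k < n) q ^+ k) <= 2^-1 * (2 * 1).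
    by apply: ler_pM => //; [exact: ltW|apply: sumr_ge0 => k _; rewrite exprn_ge0 // ltW].
  lra.
rewrite add0r.
have := IH (t / q); rewrite divr_ge0 // ?(ltW q0) // => /(_ isT) h.
have -> : 2 * t = q * (2 * (t / q)) by field; rewrite gt_eqF.
apply: le_trans (ler_wpM2l (ltW q0) h); rewrite mulr_sumr; apply: ler_sum => k _.
rewrite exprS ler_pdivlMr // [q ^+ k * q]mulrC.
by case: ifP; rewrite ?mulr0.
Qed.


Section ProductWeight.
Context (R : realType) (I J : finType) (w : J -> R).
Hypothesis w1 : \sum_k w k = 1.

Definition prodw (o : {ffun I -> J}) : R := \prod_i w (o i).

(** Independence of the coordinates: the product of sums expands into a sum over choice
    functions. *)
Lemma prodw_expect (g : I -> J -> R) :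
  \sum_o prodw o * \prod_i g i (o i) = \prod_i \sum_k w k * g i k.
Proof.
rewrite bigA_distr_bigA; apply: eq_bigr => o _.
by rewrite /prodw -big_split.
Qed.

Lemma prodw_sum1 : \sum_o prodw o = 1.
Proof.
by rewrite /prodw -(bigA_distr_bigA (fun _ => w)) big1.
Qed.

Lemma prodw_marginal (i : I) (f : J -> R) :
  \sum_o prodw o * f (o i) = \sum_k w k * f k.
Proof.
pose g i' k := if i' == i then f k else 1.
transitivity (\sum_o prodw o * \prod_i' g i' (o i')).
  apply: eq_bigr => o _; congr (_ * _).
  by rewrite (bigD1 i) //= /g eqxx big1 ?mulr1 // => i' ni; rewrite (negPf ni).
rewrite prodw_expect (bigD1 i) //= /g eqxx [X in _ * X]big1 ?mulr1 // => i' ni.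
by under eq_bigr do rewrite (negPf ni) mulr1.
Qed.

End ProductWeight.

(** Turns an expected number of independent successes into a chance of at least one. The induction
    step is (1 - a) (1 + a + S) <= 1 + S. *)
Lemma prod_1B_le (R : realType) (I : finType) (q : I -> R) :
  (forall i, 0 <= q i <= 1) -> (\prod_i (1 - q i)) * (1 + \sum_i q i) <= 1.
Proof.
move=> q01; rewrite -!big_enum /=; elim: (enum I) => [|i s IH].
  by rewrite !big_nil addr0 mulr1.
rewrite !big_cons; have /andP[q0 q1] := q01 i.
have P0 : 0 <= \prod_(j <- s) (1 - q j).
  by apply: prodr_ge0 => j _; rewrite subr_ge0; case/andP: (q01 j).
have S0 : 0 <= \sum_(j <- s) q j by apply: sumr_ge0 => j _; case/andP: (q01 j).
move: (\prod_(j <- s) _) (\sum_(j <- s) _) (q i) P0 S0 q0 q1 IH => P S a P0 S0 a0 a1 IH.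
have h1 : 0 <= P * a * (a + S) by rewrite !mulr_ge0 // addr_ge0.
lra.
Qed.

(** [y] is recovered from the pairs [(i, y i)] where it differs from [z]. The list is padded to
    length [k] by [(i0, y i0)], which is also a true record of [y]. *)
Lemma card_sparse_le (I T : finType) (z : {ffun I -> T}) (k : nat) :
  (0 < #|I|)%N ->
  (#|{: {y : {ffun I -> T} | #|[set i | y i != z i]| <= k}}|
     <= (#|I| * #|T|) ^ k)%N.
Proof.
move=> /card_gt0P[i0 _].
pose S (y : {ffun I -> T}) := [set i | y i != z i].
pose l (y : {ffun I -> T}) : seq (I * T) :=
  [seq (i, y i) | i <- enum (S y)] ++ nseq (k - #|S y|) (i0, y i0).
have lP y : (#|S y| <= k)%N -> size (l y) == k.
  by move=> yk; rewrite size_cat size_map size_nseq -cardE subnKC.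
have lE y q : q \in l y -> q.2 = y q.1.
  by rewrite mem_cat => /orP[/mapP[i _ ->]//|/nseqP[-> _]].
pose f (y : {y : {ffun I -> T} | (#|S y| <= k)%N}) : k.-tuple (I * T) :=
  Tuple (lP (val y) (valP y)).
have f_inj : injective f.
  move=> y y' /(congr1 val) /= ll'; apply/val_inj/ffunP => i /=.
  have [iS|iS] := boolP (i \in S (val y)).
    have : (i, val y i) \in l (val y) by rewrite mem_cat map_f // mem_enum.
    by rewrite ll' => /lE.
  have [iS'|iS'] := boolP (i \in S (val y')).
    have : (i, val y' i) \in l (val y') by rewrite mem_cat map_f // mem_enum.
    by rewrite -ll' => /lE.
  by move: iS iS'; rewrite !inE !negbK => /eqP -> /eqP ->.
by have := leq_card f f_inj; rewrite card_tuple card_prod.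
Qed.

(** The geometric law of ratio 1/4, cut off at [N] to keep the sample space finite. *)
Definition geomw (R : realType) (N : nat) (k : 'I_N.+1) : R :=
  4^-1 ^+ k / \sum_(j < N.+1) 4^-1 ^+ j.

Lemma geomw_norm (R : realType) (N : nat) :
  1 <= (\sum_(j < N.+1) 4^-1 ^+ j : R) <= 2.
Proof.
apply/andP; split.
  by rewrite big_ord_recl expr0 lerDl sumr_ge0.
have := @geometric_tail_le R 4^-1 1 N.+1; rewrite mulr1.
have q1 k : 4^-1 ^+ k <= 1 :> R by apply: exprn_ile1; lra.
under eq_bigr do rewrite q1.
by apply; lra.
Qed.

Lemma geomw_sum1 (R : realType) (N : nat) : \sum_k @geomw R N k = 1.
Proof.
rewrite -mulr_suml divff // gt_eqF //.
by case/andP: (geomw_norm R N) => /(lt_le_trans ltr01).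
Qed.

Lemma geomw_bounds (R : realType) (N : nat) (k : 'I_N.+1) :
  2^-1 * 4^-1 ^+ k <= geomw R k <= 4^-1 ^+ k.
Proof.
rewrite /geomw; case/andP: (geomw_norm R N).
move: (\sum_(j < _) _) => S S1 S2.
have S0 : 0 < S by exact: lt_le_trans S1.
have q0 : 0 <= 4^-1 ^+ k :> R by rewrite exprn_ge0 // invr_ge0.
rewrite ler_pdivlMr // ler_pdivrMr //; move: (_ ^+ k) q0 => q q0.
by apply/andP; split; nra.
Qed.

Lemma geomw_ge0 (R : realType) (N : nat) (k : 'I_N.+1) : 0 <= geomw R k.
Proof.
case/andP: (geomw_bounds R k) => h _; apply: le_trans h.
by rewrite mulr_ge0 // ?exprn_ge0 // invr_ge0.
Qed.

Lemma prodw_ge0 (R : realType) (I : finType) (N : nat) (o : {ffun I -> 'I_N.+1}) :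
  0 <= prodw (@geomw R N) o.
Proof. by apply: prodr_ge0 => i _; exact: geomw_ge0. Qed.

(* u = 4^(k/p), so that u^p = 4^k has weight of order 4^-k. *)
Definition scaling (R : realType) (p : R) (k : nat) : R := (4 ^+ k) `^ p^-1.

Lemma scaling_ge0 (R : realType) (p : R) k : 0 <= scaling p k.
Proof. exact: powR_ge0. Qed.

Lemma scaling_powR (R : realType) (p a : R) (k : nat) : 0 < p -> 0 <= a ->
  (scaling p k * a) `^ p = 4 ^+ k * a `^ p.
Proof.
by move=> p0 a0; rewrite powRM ?scaling_ge0 // powRKV // exprn_ge0.
Qed.

Lemma le_scaling (R : realType) (p a t : R) (k : nat) :
  0 < p -> 0 <= a -> 0 <= t ->
  (t <= scaling p k * a) = (t `^ p <= 4 ^+ k * a `^ p).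
Proof.
move=> p0 a0 t0; rewrite -scaling_powR // ge0_ler_powR2 //.
by rewrite mulr_ge0 ?scaling_ge0.
Qed.

(** Coordinate i reaches [t] when 4^-k <= |a_i|^p / t^p, and the weights of these k form a geometric
    tail. *)
Lemma scaling_count_le (R : realType) (I : finType) (N : nat) (p t : R)
    (a : I -> R) : 0 < p -> 0 < t ->
  \sum_(o : {ffun I -> 'I_N.+1}) prodw (@geomw R N) o *
     (\sum_i (t <= scaling p (o i) * `|a i|)%R%:R) <=
  2 * (pnorm p a / t) `^ p.
Proof.
move=> p0 t0.
under eq_bigr do rewrite mulr_sumr.
rewrite exchange_big /=.
have tp0 : 0 < t `^ p by exact: powR_gt0.
have -> : 2 * (pnorm p a / t) `^ p = \sum_i 2 * (`|a i| `^ p / t `^ p).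
  rewrite -mulr_sumr -mulr_suml -pnorm_powR // powRM ?pnorm_ge0 ?invr_ge0 ?(ltW t0) //.
  by congr (_ * (_ * _)); rewrite -(powR_inv1 (ltW t0)) powRAC powR_inv1 // ltW.
apply: ler_sum => i _.
rewrite (prodw_marginal (geomw_sum1 R N) i (fun k => (t <= scaling p k * `|a i|)%R%:R)).
have q0 : 0 <= `|a i| `^ p / t `^ p by rewrite divr_ge0 ?powR_ge0.
apply: le_trans (@geometric_tail_le R 4^-1 _ N.+1 _ _ q0); last 2 first.
- by rewrite invr_gt0.
- by rewrite lef_pV2 ?posrE //; lra.
apply: ler_sum => k _; case/andP: (geomw_bounds R k) => _ wk.
rewrite le_scaling ?(ltW t0) // ler_pdivlMr // exprVn ler_pdivrMl ?exprn_gt0 //.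
by case: ifP => _; rewrite ?mulr1 ?mulr0 // -exprVn.
Qed.

(** Coordinate i alone reaches the norm with probability at least b_i / 8, where the b_i = |a_i|^p /
    |a|_p^p sum to 1. By independence all fail with probability at most 1 / (1 + 1/8) = 8/9. *)
Lemma scaling_hit_ge (R : realType) (I : finType) (N : nat) (p : R)
    (a : I -> R) : 0 < p -> 0 < pnorm p a ->
  (forall i, a i != 0 -> pnorm p a `^ p <= 4 ^+ N * `|a i| `^ p) ->
  9^-1 <= \sum_(o : {ffun I -> 'I_N.+1}) prodw (@geomw R N) o *
     [exists i, (pnorm p a <= scaling p (o i) * `|a i|)%R]%:R.
Proof.
move=> p0 A0 aN.
have [A AE] : exists A, A = pnorm p a by exists (pnorm p a).
rewrite -AE in A0 aN *.
have Ap0 : 0 < A `^ p by exact: powR_gt0.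
pose hit i (k : 'I_N.+1) := A <= scaling p k * `|a i|.
pose q i := \sum_k geomw R k * (hit i k)%:R.
have hitE : \sum_(o : {ffun I -> 'I_N.+1}) prodw (@geomw R N) o *
     [exists i, (A <= scaling p (o i) * `|a i|)%R]%:R + \prod_i (1 - q i) = 1.
  have -> : \prod_i (1 - q i) = \prod_i \sum_k geomw R k * (1 - (hit i k)%:R).
    apply: eq_bigr => i _; rewrite -[in LHS](geomw_sum1 R N) -sumrB.
    by apply: eq_bigr => k _; rewrite mulrBr mulr1.
  rewrite -prodw_expect -big_split -[RHS](prodw_sum1 I (geomw_sum1 R N)) /=.
  apply: eq_bigr => o _; rewrite -mulrDr -[RHS]mulr1; congr (_ * _).
  case: (boolP [exists i, _]) => [/existsP[i hi]|].
    by rewrite (bigD1 i) //= /hit hi subrr mul0r addr0.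
  rewrite negb_exists => /forallP nh; rewrite big1 ?add0r // => i _.
  by rewrite /hit (negPf (nh i)) subr0.
pose b i := `|a i| `^ p / A `^ p.
have b0 i : 0 <= b i by rewrite divr_ge0 ?powR_ge0.
have b1 : \sum_i b i = 1.
  by rewrite -mulr_suml -pnorm_powR // -AE divff // gt_eqF.
have q01 i : 0 <= q i <= 1.
  apply/andP; split.
    by apply: sumr_ge0 => k _; rewrite mulr_ge0 ?geomw_ge0.
  rewrite -(geomw_sum1 R N); apply: ler_sum => k _.
  by case: (hit i k); rewrite ?mulr1 ?mulr0 ?geomw_ge0.
(* For a nonzero coordinate the least k with 4^k b_i >= 1 has 4^-k >= b_i / 4 and weight at least
   half of 4^-k; [aN] places it within the range. *)
have qb i : b i / 8 <= q i.
  have [ai|ai] := eqVneq (a i) 0.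
    rewrite /b ai normr0 powR0 ?gt_eqF // !mul0r.
    by case/andP: (q01 i).
  pose P k := 1 <= 4 ^+ k * b i.
  have PE (k : nat) : P k = (A <= scaling p k * `|a i|).
    by rewrite le_scaling ?(ltW A0) // /P /b mulrA ler_pdivlMr // mul1r.
  have PN : exists k, P k.
    by exists N; rewrite /P /b mulrA ler_pdivlMr // mul1r aN.
  case: (ex_minnP PN) => k Pk kmin.
  have kN : (k < N.+1)%N.
    by rewrite ltnS kmin // /P /b mulrA ler_pdivlMr // mul1r aN.
  have bk : b i / 4 <= 4^-1 ^+ k.
    case: k Pk kmin kN => [|k] _ kmin _.
      rewrite expr0; have : b i <= 1.
        rewrite -b1 (bigD1 i) //= lerDl; exact: sumr_ge0.
      by move: (b i) => B; lra.
    have : ~~ P k by apply/negP => /kmin; rewrite ltnn.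
    rewrite /P -ltNge => h; rewrite exprS mulrC ler_wpM2l ?invr_ge0 //.
    by rewrite exprVn -[leRHS]mulr1 -ler_pdivrMl ?invr_gt0 ?exprn_gt0 // invrK ltW.
  apply: (@le_trans _ _ (geomw R (Ordinal kN))).
    case/andP: (geomw_bounds R (Ordinal kN)) => h _; apply: le_trans h => /=.
    by move: (b i) (_ ^+ k) bk => B Q; lra.
  rewrite /q (bigD1 (Ordinal kN)) //= /hit /= -PE Pk mulr1 lerDl.
  by apply: sumr_ge0 => j _; rewrite mulr_ge0 ?geomw_ge0.
have S : 8^-1 <= \sum_i q i.
  apply: le_trans (ler_sum _ (fun i _ => qb i)).
  by rewrite -mulr_suml b1 mul1r.
have P0 : 0 <= \prod_i (1 - q i).
  by apply: prodr_ge0 => i _; rewrite subr_ge0; case/andP: (q01 i).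
have := prod_1B_le q01; move: hitE P0 S.
move: (\sum_(o : {ffun _ -> _}) _) (\prod_i _) (\sum_i _) => E P S.
by move=> h P0 S8 PS; nra.
Qed.

(** With A = |a|_p, a scaled coordinate above A equals A t^(2/p) <= A t, where t = 2^k b_i >= 1 and
    p >= 2. So the maximum is at most A (1 + the sum of these t). Coordinate i contributes in
    expectation at most b_i times the sum of the 2^-k <= b_i, hence at most 2 b_i^2, and the b_i^2
    sum to 1. *)
Lemma scaling_max_le (R : realType) (I : finType) (N : nat) (p : R)
    (a : I -> R) : 2 <= p ->
  \sum_(o : {ffun I -> 'I_N.+1}) prodw (@geomw R N) o *
     \big[Num.max/0]_i (scaling p (o i) * `|a i|) <= 3 * pnorm p a.
Proof.
move=> p2; have p0 : 0 < p by exact: lt_le_trans p2.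
have [A0|An0] := eqVneq (pnorm p a) 0.
  rewrite A0 mulr0 big1 // => o _.
  rewrite (_ : \big[Num.max/0]_i _ = 0) ?mulr0 //.
  apply: big1_idem => [|i _]; first exact: maxxx.
  by rewrite (pnorm_eq0 i p0 A0) normr0 mulr0.
have A0 : 0 < pnorm p a by rewrite lt0r An0 pnorm_ge0.
have [A AE] : exists A, A = pnorm p a by exists (pnorm p a).
rewrite -AE in A0 An0 *.
have Ap0 : 0 < A `^ p by exact: powR_gt0.
pose b i := Num.sqrt (`|a i| `^ p / A `^ p).
have b0 i : 0 <= b i by exact: sqrtr_ge0.
have bb i : b i ^+ 2 = `|a i| `^ p / A `^ p.
  by rewrite sqr_sqrtr // divr_ge0 ?powR_ge0.
pose S i (k : 'I_N.+1) : R := if 2^-1 ^+ k <= b i then 2 ^+ k * b i else 0.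
have S0 i k : 0 <= S i k.
  by rewrite /S; case: ifP => // _; rewrite mulr_ge0 ?exprn_ge0.
have pointwise (o : {ffun I -> 'I_N.+1}) : \big[Num.max/0]_i (scaling p (o i) * `|a i|) <=
    A * (1 + \sum_i S i (o i)).
  have SS0 : 0 <= \sum_i S i (o i) by apply: sumr_ge0 => i _.
  apply/bigmax_leP; split=> [|i _].
    by rewrite mulr_ge0 ?(ltW A0) // addr_ge0.
  have [le|gt] := leP (scaling p (o i) * `|a i|) A.
    by apply: (le_trans le); rewrite -[leLHS]mulr1 ler_wpM2l ?(ltW A0) // lerDl.
  pose t := 2 ^+ o i * b i.
  have tt : t ^+ 2 = 4 ^+ o i * `|a i| `^ p / A `^ p.
    by rewrite /t exprMn bb -exprM mulnC exprM mulrA (_ : 2 ^+ 2 = 4) //; ring.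
  have t0 : 0 <= t by rewrite mulr_ge0 ?exprn_ge0.
  have t1 : 1 <= t.
    have : 1 <= t ^+ 2.
      by rewrite tt ler_pdivlMr // mul1r -le_scaling ?(ltW A0) // ltW.
    by rewrite expr2 => h; nra.
  have SE : S i (o i) = t.
    by rewrite /S exprVn -[_^-1]mulr1 ler_pdivrMl ?exprn_gt0 // t1.
  apply: (@le_trans _ _ (A * t)); last first.
    rewrite ler_wpM2l ?(ltW A0) // (bigD1 i) //= SE addrCA lerDl addr_ge0 //.
    by apply: sumr_ge0 => j _.
  have E : scaling p (o i) * `|a i| = A * (t ^+ 2) `^ p^-1.
    rewrite -[LHS](@powRVK _ p) ?mulr_ge0 ?scaling_ge0 // scaling_powR //.
    rewrite -[in RHS](@powRVK _ p A) ?(ltW A0) // -powRM ?sqr_ge0 ?(ltW Ap0) //.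
    by congr (_ `^ _); rewrite tt [RHS]mulrC divfK // gt_eqF.
  rewrite E ler_wpM2l ?(ltW A0) //.
  rewrite -powR_mulrn // -powRrM; apply: ler1_powR => //.
  by rewrite ler_pdivrMr // mul1r.
apply: (@le_trans _ _ (\sum_(o : {ffun I -> 'I_N.+1}) prodw (@geomw R N) o *
    (A * (1 + \sum_i S i (o i))))).
  by apply: ler_sum => o _; rewrite ler_wpM2l ?prodw_ge0.
under eq_bigr do rewrite mulrCA.
rewrite -mulr_sumr [3 * A]mulrC ler_wpM2l ?(ltW A0) //.
under eq_bigr do rewrite mulrDr mulr1 mulr_sumr.
rewrite big_split /= (prodw_sum1 I (geomw_sum1 R N)) exchange_big /=.
have -> : 3 = 1 + \sum_i 2 * (b i ^+ 2).
  rewrite -mulr_sumr; under eq_bigr do rewrite bb.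
  by rewrite -mulr_suml -pnorm_powR // -AE divff ?gt_eqF //; ring.
rewrite lerD2l; apply: ler_sum => i _.
rewrite (prodw_marginal (geomw_sum1 R N) i (S i)).
rewrite expr2 mulrCA.
have h2 : 0 < 2^-1 :> R by rewrite invr_gt0.
apply: (@le_trans _ _ (b i * (\sum_(k < N.+1) if 2^-1 ^+ k <= b i then 2^-1 ^+ k else 0)));
  last by rewrite ler_wpM2l // geometric_tail_le.
rewrite mulr_sumr; apply: ler_sum => k _; case/andP: (geomw_bounds R k) => _ wk.
rewrite /S; case: ifP => _; last by rewrite !mulr0.
apply: (@le_trans _ _ (4^-1 ^+ k * (2 ^+ k * b i))).
  by rewrite ler_wpM2r // mulr_ge0 ?exprn_ge0.
rewrite mulrA -exprMn mulrC (_ : 4^-1 * 2 = 2^-1) //; lra.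
Qed.

(** * The case p >= 2 *)

Definition soft (R : realType) (t a : R) : R :=
  if t <= `|a| then (if 0 <= a then a - t else a + t) else 0.

Lemma soft_lipschitz (R : realType) (t a b : R) : 0 <= t ->
  `|soft t a - soft t b| <= `|a - b|.
Proof.
move=> t0; rewrite /soft ler_norml.
have := ler_norm (a - b); have := ler_norm (- (a - b)); rewrite normrN.
move: `|a - b| => D.
case: (leP t `|a|); case: (leP t `|b|); case: (leP 0 a) => a0;
  case: (leP 0 b) => b0;
  rewrite ?(ger0_norm a0) ?(ltr0_norm a0) ?(ger0_norm b0) ?(ltr0_norm b0) => h1 h2 h3 h4;
  by apply/andP; split; lra.
Qed.

(** Thresholding keeps [b] on its side of 0 or sends it to 0, so it cannot reduce the difference
    below |soft t a| >= |a| - t. *)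
Lemma soft_opposite (R : realType) (t a b : R) : 0 <= t -> opposite 0 a b ->
  `|a| - t <= `|soft t a - soft t b|.
Proof.
move=> t0; rewrite /soft ler_normr => /orP[] /andP[h1 h2]; apply/orP;
  [right|left];
  (case: (leP t `|a|); case: (leP t `|b|); case: (leP 0 a) => a0;
  case: (leP 0 b) => b0;
  rewrite ?(ger0_norm a0) ?(ltr0_norm a0) ?(ger0_norm b0) ?(ltr0_norm b0) => h3 h4;
  lra).
Qed.

Lemma opposite_scale (R : realType) (s a b : R) : 0 <= s ->
  opposite 0 a b -> opposite 0 (s * a) (s * b).
Proof.
move=> s0 /orP[] /andP[h1 h2]; apply/orP; [left|right];
  by rewrite mulr_ge0_le0 // mulr_ge0.
Qed.

(* The range of k is finite; its size does not affect the sketch length. *)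
Lemma scaling_range_exists (R : realType) (X I : finType) (p : R) (v : X -> I -> R) :
  exists N : nat, forall x i, v x i != 0 ->
    pnorm p (v x) `^ p <= 4 ^+ N * `|v x i| `^ p.
Proof.
pose F x i := pnorm p (v x) `^ p / `|v x i| `^ p.
have F0 x i : 0 <= F x i by rewrite divr_ge0 ?powR_ge0.
pose M := \sum_x \sum_i F x i.
have M0 : 0 <= M by apply: sumr_ge0 => x _; exact: sumr_ge0.
exists (Num.truncn M).+1 => x i vi.
rewrite -ler_pdivrMr ?powR_gt0 ?normr_gt0 //.
apply: (@le_trans _ _ M).
  rewrite /M (bigD1 x) //= (bigD1 i) //= -addrA lerDl addr_ge0 ?sumr_ge0 //.
  by move=> y _; exact: sumr_ge0.
apply: (le_trans (ltW (truncnS_gt M))).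
by rewrite -natrX ler_nat ltnW // ltn_expl.
Qed.

Section SparseSketch.
Context (R : realType) (I T : finType) (e : I -> T -> R) (z : {ffun I -> T}).
Context (p t : R) (N k : nat).
Hypotheses (p2 : 2 <= p) (t0 : 0 < t) (ez : forall i, e i (z i) = 0).

Local Notation X := {ffun I -> T}.
Local Notation Omega := {ffun I -> 'I_N.+1}.
Local Notation sparse := {y : X | (#|[set i | y i != z i]| <= k)%N}.
Let v (x : X) i := e i (x i).
Let dist x y := pnorm p (fun i => v x i - v y i).
Let W (o : Omega) : R := prodw (@geomw R N) o.
Let scale (o : Omega) i : R := scaling p (o i).

(** Small coordinates are reset to [z], where [e] vanishes. Soft thresholding does not see the
    change, and only the large coordinates need storing. *)
Definition sparsify (o : Omega) (x : X) : X :=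
  [ffun i => if t <= scale o i * `|v x i| then x i else z i].

(* [None], i.e. more than k large coordinates, is a failure: Alg then answers 0. *)
Definition sparse_sk (o : Omega) (x : X) : option sparse := insub (sparsify o x).

(** The factor 1/3 cancels the constant of [scaling_max_le]. *)
Definition sparse_alg (o : Omega) (a b : option sparse) : R :=
  if (a, b) is (Some a', Some b') then
    3^-1 * \big[Num.max/0]_i `|soft t (scale o i * v (val a') i) -
                              soft t (scale o i * v (val b') i)|
  else 0.

Let soft_sparsify o x i :
  soft t (scale o i * v (sparsify o x) i) = soft t (scale o i * v x i).
Proof.
rewrite /v ffunE; case: ifP => // /negbT; rewrite -ltNge => h.
rewrite ez mulr0 /soft normr0 leNgt t0 /=.
by rewrite normrM (ger0_norm (scaling_ge0 _ _)) leNgt h.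
Qed.

Lemma sparse_alg_ge0 o a b : 0 <= sparse_alg o a b.
Proof.
rewrite /sparse_alg; case: a => // a; case: b => // b.
by rewrite mulr_ge0 // ?invr_ge0 //; exact: bigmax_ge_id.
Qed.

Lemma sparse_alg_expect_le x y :
  \sum_o W o * sparse_alg o (sparse_sk o x) (sparse_sk o y) <= dist x y.
Proof.
have := scaling_max_le N (fun i => v x i - v y i) p2.
rewrite -ler_pdivrMl // mulr_sumr; apply: le_trans.
apply: ler_sum => o _; rewrite mulrCA ler_wpM2l ?prodw_ge0 //.
have M0 : 0 <= 3^-1 * \big[Num.max/0]_i (scaling p (o i) * `|v x i - v y i|).
  by rewrite mulr_ge0 ?invr_ge0 //; exact: bigmax_ge_id.
rewrite /sparse_alg /sparse_sk.
case: insubP => //= a _ ->; case: insubP => //= b _ ->.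
rewrite ler_wpM2l ?invr_ge0 //; apply: le_bigmax2 => i _.
rewrite !soft_sparsify; apply: (le_trans (soft_lipschitz _ _ (ltW t0))).
by rewrite -mulrBr normrM (ger0_norm (scaling_ge0 _ _)).
Qed.

Definition fits o x := (#|[set i | sparsify o x i != z i]| <= k)%N.

Definition hits o x y := [exists i,
  (pnorm p (v x) <= scale o i * `|v x i|) && opposite 0 (v x i) (v y i)].

(** The coordinate witnessing [hits] suffices: its scaled size is at least the norm of [v x], and
    [soft_opposite] loses only [t]. *)
Lemma sparse_alg_ge o x y : fits o x -> fits o y -> hits o x y ->
  3^-1 * (pnorm p (v x) - t) <= sparse_alg o (sparse_sk o x) (sparse_sk o y).
Proof.
move=> fx fy /existsP[i /andP[hi opp]].
rewrite /sparse_alg /sparse_sk.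
case: insubP => [a _ aE|]; last by rewrite -/(fits o x) fx.
case: insubP => [b _ bE|]; last by rewrite -/(fits o y) fy.
rewrite aE bE ler_wpM2l ?invr_ge0 //.
apply: le_trans (le_bigmax _ _ i); rewrite !soft_sparsify.
have s0 : 0 <= scale o i by exact: scaling_ge0.
apply: le_trans (soft_opposite (ltW t0) (opposite_scale s0 opp)).
by rewrite normrM (ger0_norm s0) lerB.
Qed.

(** Markov's inequality for the number of scaled coordinates that reach [t]. *)
Lemma fits_fail_le x : (0 < k)%N ->
  \sum_o W o * (~~ fits o x)%:R <= 2 * (pnorm p (v x) / t) `^ p / k%:R.
Proof.
move=> k0; have p0 : 0 < p by exact: lt_le_trans p2.
rewrite ler_pdivlMr ?ltr0n // mulr_suml.
apply: le_trans (scaling_count_le N (v x) p0 t0).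
apply: ler_sum => o _; rewrite -mulrA ler_wpM2l ?prodw_ge0 //.
case: (boolP (fits o x)) => [_|]; first by rewrite mul0r sumr_ge0.
rewrite -ltnNge mul1r => kl.
rewrite -natr_sum ler_nat; apply: (leq_trans (ltnW kl)).
rewrite -sum1_card big_mkcond /=; apply: leq_sum => i _.
rewrite inE ffunE /scale.
case: (t <= scaling p (o i) * `|v x i|) => /=; first by case: ifP.
by rewrite eqxx.
Qed.

End SparseSketch.

(** A union bound for indicators: it is linear in the failures, so expectations can be taken even
    though the events are dependent. *)
Lemma indicator_diff_le0 (R : realType) (a b c d e : bool) :
  ~~ [&& a, b, c, d & e] ->
  a%:R * b%:R - a%:R * (~~ c)%:R - (~~ d)%:R - d%:R * (~~ e)%:R <= 0 :> R.
Proof.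
rewrite -!natrM !mulnb -!addrA -!opprD subr_le0 -!natrD ler_nat.
by case: a b c d e => [] [] [] [] [].
Qed.

Lemma sparse_sketch (R : realType) (I T : finType) (e : I -> T -> R)
    (z : {ffun I -> T}) (mu : {ffun I -> T} -> R) (g : pred {ffun I -> T})
    (p m c delta : R) (k : nat) :
  let v (x : {ffun I -> T}) i := e i (x i) in
  let dist x y := pnorm p (fun i => v x i - v y i) in
  2 <= p -> 0 < m -> 0 < delta -> delta <= 8^-1 -> 3 * 100 <= c * delta -> 0 < c ->
  (forall i, e i (z i) = 0) ->
  (forall x, 0 <= mu x) -> \sum_x mu x = 1 ->
  (forall i, 2^-1 <= \sum_(x | v x i <= 0) mu x) ->
  (forall i, 2^-1 <= \sum_(x | 0 <= v x i) mu x) ->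
  (forall x, g x -> (1 - delta) * m <= pnorm p (v x) <= (1 + delta) * m) ->
  \sum_(x | ~~ g x) mu x <= 100^-1 ->
  \sum_x \sum_y mu x * mu y * dist x y <= 3 * m ->
  4 * 100 * ((1 + delta) / (1 - 2 * delta)) `^ p <= k%:R ->
  finite_sketch (option {y : {ffun I -> T} | (#|[set i | y i != z i]| <= k)%N})
    dist mu c.
Proof.
move=> v dist p2 m0 d0 d8 cd c0 ez mu0 mu1 lo hi gP bad avg kP.
have p0 : 0 < p by exact: lt_le_trans p2.
have th0 : 0 < 1 - 2 * delta by lra.
have t0 : 0 < (1 - 2 * delta) * m by rewrite mulr_gt0.
have k0 : (0 < k)%N.
  rewrite -(ltr0n R); apply: lt_le_trans kP.
  apply: mulr_gt0; first by rewrite mulr_gt0 // ltr0n.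
  by apply: powR_gt0; apply: divr_gt0 => //; lra.
have [N NP] := scaling_range_exists p v.
set t := (1 - 2 * delta) * m in t0 *.
exists {ffun I -> 'I_N.+1}, (prodw (@geomw R N)), (sparse_sk e z p t k),
  (@sparse_alg R I T e z p t N k); split.
- split; first exact: prodw_ge0.
  exact: prodw_sum1 (geomw_sum1 R N).
- exact: sparse_alg_ge0.
- by move=> x y; exact: sparse_alg_expect_le.
pose W (o : {ffun I -> 'I_N.+1}) : R := prodw (@geomw R N) o.
pose h x y := \sum_o W o * (@hits R I T e p N o x y)%:R.
pose f x := \sum_o W o * (~~ @fits R I T e z p t N k o x)%:R.
(* On the annulus norm / t <= (1 + delta) / (1 - 2 delta), so the choice of [k] leaves 2 / 400. *)
have fP x : g x -> f x <= 200^-1.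
  move=> gx; apply: (le_trans (fits_fail_le e z N p2 t0 x k0)).
  rewrite ler_pdivrMr ?ltr0n // ler_pdivlMl // mulrA (_ : 200 * 2 = 4 * 100); last by ring.
  apply: le_trans kP; apply: ler_wpM2l; first by apply: mulr_ge0; exact: ler0n.
  rewrite ge0_ler_powR2 //.
  - rewrite ler_pdivrMr // /t mulrA divfK ?gt_eqF //.
    by case/andP: (gP x gx).
  - by rewrite divr_ge0 ?pnorm_ge0 // ltW.
  - by rewrite divr_ge0 // ?(ltW th0) //; lra.
pose A x y := \sum_o W o *
  @sparse_alg R I T e z p t N k o (sparse_sk e z p t k o x) (sparse_sk e z p t k o y).
(* The answer guaranteed by a hit, since norm - t >= delta m on the annulus. *)
have [B BE] : exists B, B = 3^-1 * (delta * m) by exists (3^-1 * (delta * m)).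
have B0 : 0 <= B by rewrite BE mulr_ge0 ?invr_ge0 // mulr_ge0 // ltW.
have pair x y : B * ((g x)%:R * h x y - 200^-1 - (~~ g y)%:R - 200^-1) <= A x y.
  apply: (@le_trans _ _ (B * ((g x)%:R * h x y - (g x)%:R * f x - (~~ g y)%:R -
      (g y)%:R * f y))).
    have gf u : (g u)%:R * f u <= 200^-1.
      by case: (boolP (g u)) => gu; rewrite ?mul1r ?fP // mul0r invr_ge0.
    by rewrite ler_wpM2l // !lerB.
  have W1 : \sum_o W o = 1 := prodw_sum1 I (geomw_sum1 R N).
  rewrite /h /f -[(~~ g y)%:R]mul1r -[X in X * (~~ g y)%:R]W1 mulr_suml !mulr_sumr -!sumrB mulr_sumr.
  apply: ler_sum => o _.
  have Alg0 := @sparse_alg_ge0 R I T e z p t N k o (sparse_sk e z p t k o x) (sparse_sk e z p t k o y).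
  have W0 : 0 <= W o := prodw_ge0 R o.
  have := @sparse_alg_ge R I T e z p t N k t0 ez o x y.
  move: (sparse_alg e p t o _ _) Alg0 => Q Q0 HQ.
  rewrite (_ : B * _ = W o * (B * ((g x)%:R * (hits e p o x y)%:R -
    (g x)%:R * (~~ fits e z p t k o x)%:R - (~~ g y)%:R -
    (g y)%:R * (~~ fits e z p t k o y)%:R))); last by ring.
  rewrite ler_wpM2l //.
  case: (boolP [&& g x, hits e p o x y, fits e z p t k o x, g y & fits e z p t k o y]);
    last by move=> /(indicator_diff_le0 R) h0; apply: (@le_trans _ _ 0) => //;
      rewrite mulr_ge0_le0.
  move=> /and5P[gx hxy fx -> fy]; rewrite gx hxy fx fy !mulr0 !subr0 !mulr1 BE.
  apply: le_trans (HQ fx fy hxy).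
  rewrite ler_wpM2l ?invr_ge0 //; case/andP: (gP x gx) => r1 _; rewrite /t.
  by move: (pnorm p _) r1 => r; lra.
(* The scaling of [x] hits with probability 1/9. The coordinate hit depends only on [x] and [o], so
   an independent [y] is across its median with probability at least 1/2. *)
have hP x : g x -> 18^-1 <= \sum_y mu y * h x y.
  move=> gx.
  have r0 : 0 < pnorm p (v x).
    case/andP: (gP x gx) => r1 _; apply: lt_le_trans r1.
    by apply: mulr_gt0 => //; lra.
  have H := @scaling_hit_ge R I N p (v x) p0 r0 (NP x).
  apply: (@le_trans _ _ (\sum_o (W o * [exists i, (pnorm p (v x) <=
      scaling p (o i) * `|v x i|)%R]%:R) * 2^-1)).
    by rewrite -mulr_suml; move: H; rewrite -/W; lra.
  rewrite /h; under [leRHS]eq_bigr do rewrite mulr_sumr.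
  rewrite exchange_big /=; apply: ler_sum => o _.
  under [leRHS]eq_bigr do rewrite mulrCA.
  rewrite -mulr_sumr -mulrA ler_wpM2l ?prodw_ge0 //.
  case: (boolP [exists i, _]) => [/existsP[i hi_]|_]; last first.
    by rewrite mul0r sumr_ge0 // => y _; rewrite mulr_ge0.
  rewrite mul1r; apply: (le_trans (opposite_mass (v x i) mu0 (lo i) (hi i))).
  rewrite big_mkcond /=; apply: ler_sum => y _; case: ifP => [opp|_]; last first.
    by rewrite mulr_ge0.
  suff -> : hits e p o x y by rewrite mulr1.
  by apply/existsP; exists i; rewrite hi_ opp.
have good : 99 / 100 <= \sum_(x | g x) mu x.
  by move: mu1; rewrite (bigID g) /=; lra.
(* The losses are 1/200 for each of the two messages not fitting and 1/100 for [y] outside [g]. *)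
apply: (@le_trans _ _ (\sum_x mu x * (B * ((g x)%:R / 18 - 100^-1 - 100^-1)))); last first.
  apply: ler_sum => x _.
  under [leRHS]eq_bigr do rewrite -mulrA.
  rewrite -mulr_sumr ler_wpM2l //.
  apply: (@le_trans _ _ (\sum_y mu y *
      (B * ((g x)%:R * h x y - 200^-1 - (~~ g y)%:R - 200^-1)))); last first.
    by apply: ler_sum => y _; rewrite ler_wpM2l //; exact: pair.
  rewrite (eq_bigr (fun y => B * ((g x)%:R * (mu y * h x y) - mu y * 200^-1 -
    mu y * (~~ g y)%:R - mu y * 200^-1))); last by move=> y _; ring.
  rewrite -mulr_sumr ler_wpM2l // !sumrB -mulr_sumr -!mulr_suml mu1 mul1r.
  have -> : \sum_y mu y * (~~ g y)%:R = \sum_(y | ~~ g y) mu y.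
    by rewrite [RHS]big_mkcond; apply: eq_bigr => y _; case: (g y); rewrite /= ?mulr1 ?mulr0.
  move: bad; move: (\sum_(y | _) mu y) => b hb.
  case: (boolP (g x)) => gx; rewrite ?mul1r ?mul0r; last by lra.
  by move: (hP x gx); move: (\sum_y _) => H; lra.
have -> : \sum_x mu x * (B * ((g x)%:R / 18 - 100^-1 - 100^-1)) =
    B * ((\sum_(x | g x) mu x) / 18 - 50^-1).
  under eq_bigr do rewrite mulrCA.
  rewrite -mulr_sumr; congr (_ * _).
  under eq_bigr do rewrite -addrA mulrDr mulrA.
  rewrite big_split /= -!mulr_suml mu1 mul1r; congr (_ / _ + _); last by lra.
  by rewrite [RHS]big_mkcond; apply: eq_bigr => y _; case: (g y); rewrite /= ?mulr1 ?mulr0.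
apply: (@le_trans _ _ (c^-1 * (3 * m))); first by rewrite ler_wpM2l // invr_ge0 ltW.
(* (99/100) / 18 - 1/50 >= 1/30, while 3 m / c <= B / 30 amounts to c delta >= 270. *)
apply: (@le_trans _ _ (B * 30^-1)); last by rewrite ler_wpM2l //; lra.
rewrite ler_pdivrMl // BE.
by have := ler_wpM2r (ltW m0) cd; lra.
Qed.

(** * Assembling the sketch *)

Lemma lp_finite_sketch (R : realType) (d Delta : nat)
    (mu : {ffun 'I_d -> 'I_Delta} -> R) (p c delta : R) (k : nat) :
  let dist (x y : {ffun 'I_d -> 'I_Delta}) :=
    pnorm p (fun i => (x i : nat)%:R - (y i : nat)%:R) in
  1 <= p -> 0 < delta -> delta <= 8^-1 -> c * delta = 8 * 100 -> 10 * 100 <= c ->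
  4 * 100 * ((1 + delta) / (1 - 2 * delta)) `^ p <= k%:R ->
  (forall x, 0 <= mu x) -> \sum_x mu x = 1 ->
  finite_sketch (bool * bool)%type dist mu c \/
  exists z : {ffun 'I_d -> 'I_Delta},
    finite_sketch (option {y : {ffun 'I_d -> 'I_Delta} |
      (#|[set i | y i != z i]| <= k)%N}) dist mu c.
Proof.
move=> dist p1 d0 d8 cd c1 kP mu0 mu1.
have c0 : 0 < c by apply: lt_le_trans c1; rewrite mulr_gt0 // ltr0n.
have p0 : 0 < p by exact: lt_le_trans p1.
have /choice[xz xzP] (i : 'I_d) := @median_exists R _ mu (fun x => (x i : nat)%:R) mu0 mu1.
pose z : {ffun 'I_d -> 'I_Delta} := [ffun i => xz i i].
pose e (i : 'I_d) (j : 'I_Delta) : R := (j : nat)%:R - (z i : nat)%:R.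
pose v (x : {ffun 'I_d -> 'I_Delta}) (i : 'I_d) := e i (x i).
have lo i : 2^-1 <= \sum_(x | v x i <= 0) mu x.
  case: (xzP i) => h _; apply: (le_trans h); apply: ler_sum_pred => // x.
  by rewrite /v /e /z ffunE subr_le0.
have hi i : 2^-1 <= \sum_(x | 0 <= v x i) mu x.
  case: (xzP i) => _ h; apply: (le_trans h); apply: ler_sum_pred => // x.
  by rewrite /v /e /z ffunE subr_ge0.
have -> : dist = (fun x y => pnorm p (fun i => v x i - v y i)).
  apply/funext => x; apply/funext => y; apply: eq_pnorm_abs => i.
  by congr (`|_|); rewrite /v /e; ring.
clear dist; set dist := (fun x y => _).
pose r x := pnorm p (v x).
have tri x y : dist x y <= r x + r y.
  have -> : r y = pnorm p (fun i => - v y i).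
    by apply: eq_pnorm_abs => i; rewrite normrN.
  exact: pnormD.
have dC x y : dist x y = dist y x.
  by apply: eq_pnorm_abs => i; rewrite distrC.
have lip x y : `|r x - r y| <= dist x y.
  suff H u w : r u - r w <= dist u w by rewrite ler_norml lerNl opprB dC H dC H.
  rewrite lerBlDr; have := pnormD (fun i => v u i - v w i) (v w) p1.
  by apply: le_trans; rewrite le_eqVlt; apply/orP; left; apply/eqP/eq_pnorm_abs => i;
    rewrite subrK.
have [x0 [rlo rhi]] := @median_exists R _ mu r mu0 mu1.
have [m mE] : exists m, m = r x0 by exists (r x0).
rewrite -mE in rlo rhi.
have avg := mean_dist_le mu0 mu1 tri.
pose D := \sum_x mu x * r x.
pose E := \sum_x mu x * `|r x - m|.
have ci0 : 0 <= c^-1 by rewrite invr_ge0 ltW.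
have D0 : 0 <= D by apply: sumr_ge0 => x _; rewrite mulr_ge0 ?pnorm_ge0.
(* The mean distance is at most 2 D, and the radial sketch recovers E / 2. *)
have [caseA|caseB] := leP (4 * c^-1 * D) E.
  left; apply: (radial_sketch mu0 lip rlo rhi); rewrite -/E.
  have := ler_wpM2l ci0 avg; rewrite -/D.
  move: (c^-1 * _) => Q.
  by move: caseA; clear; move: E D (c^-1) => E D C h1 h2; lra.
have DE : D <= E + m.
  have -> : m = \sum_x mu x * m by rewrite -mulr_suml mu1 mul1r.
  rewrite -big_split; apply: ler_sum => x _ /=; rewrite -mulrDr ler_wpM2l //.
  by rewrite -lerBlDr ler_norm.
(* Now E <= D / 3, so D <= E + m gives 2 D <= 3 m; as D > 0 by the strict inequality [caseB], also m
   > 0. *)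
have ci : c^-1 <= 12^-1.
  by rewrite lef_pV2 ?posrE //; apply: le_trans c1; rewrite -natrM ler_nat.
have E0 : 0 <= E by apply: sumr_ge0 => x _; rewrite mulr_ge0.
have cD : 4 * c^-1 * D <= 3^-1 * D by rewrite ler_wpM2r //; lra.
have D1 : 0 < D.
  rewrite lt0r D0 andbT; apply/eqP => D00.
  by move: caseB; rewrite D00 mulr0 ltNge E0.
have Dm : 2 * D <= 3 * m by lra.
have m0 : 0 < m by lra.
have dm0 : 0 < delta * m by rewrite mulr_gt0.
pose g x := `|r x - m| <= delta * m.
(* Markov's inequality: the mass outside the annulus is at most E / (delta m) <= 4 D / (800 m) <= 6
   / 800. *)
have bad : \sum_(x | ~~ g x) mu x <= 100^-1.
  have h1 : (\sum_(x | ~~ g x) mu x) * (delta * m) <= E.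
    rewrite mulr_suml big_mkcond /=; apply: ler_sum => x _; case: ifP => [|_].
      by rewrite /g -ltNge => h; rewrite ler_wpM2l // ltW.
    by rewrite mulr_ge0.
  have h2 : c * ((\sum_(x | ~~ g x) mu x) * (delta * m)) <= 6 * m.
    apply: (@le_trans _ _ (c * (4 * c^-1 * D))).
      by rewrite ler_wpM2l ?(ltW c0) // (le_trans h1) // ltW.
    by rewrite mulrA mulrCA mulfV ?gt_eqF // mulr1; lra.
  have h3 : (\sum_(x | ~~ g x) mu x) * (8 * 100) <= 6.
    rewrite -(ler_pM2r m0) -cd; apply: le_trans h2.
    by rewrite le_eqVlt; apply/orP; left; apply/eqP; ring.
  lra.
have avg3 : \sum_x \sum_y mu x * mu y * dist x y <= 3 * m by exact: le_trans Dm.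
have gP x : g x -> (1 - delta) * m <= r x <= (1 + delta) * m.
  by rewrite /g ler_norml => /andP[h1 h2]; apply/andP; split; lra.
have [p2|p2] := leP p 2.
  left; apply: (mazur_sketch (g := g) (m := m)) => // x /gP /andP[h1 h2].
  have dm8 : delta * m <= 8^-1 * m by rewrite ler_wpM2r // ltW.
  by rewrite -/(r x); apply/andP; split; lra.
right; exists z.
apply: (sparse_sketch (g := g) (m := m) (delta := delta)) => //.
- exact: ltW.
- by rewrite cd -!natrM ler_nat.
- by move=> i; rewrite /e subrr.
Qed.

(** * Bounding the number of bits *)

Lemma ln2_ge_half (R : realType) : 2^-1 <= ln 2 :> R.
Proof.
have := @le_ln1Dx R (- 2^-1).
have -> : 1 + - 2^-1 = 2^-1 :> R by lra.
by rewrite lnV ?posrE // lerN2; apply; lra.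
Qed.

(** For delta <= 1/8 the ratio is at most 1 + 4 delta <= exp (4 delta). *)
Lemma ratio_powR_le (R : realType) (p delta : R) :
  1 <= p -> 0 < delta -> delta <= 8^-1 ->
  ((1 + delta) / (1 - 2 * delta)) `^ p <= expR (4 * delta * p).
Proof.
move=> p1 d0 d8; rewrite expRM.
have e0 : 0 <= expR (4 * delta) by exact: expR_ge0.
have th0 : 0 < 1 - 2 * delta by lra.
have r0 : 0 <= (1 + delta) / (1 - 2 * delta) by rewrite divr_ge0 ?(ltW th0) //; lra.
rewrite ge0_ler_powR2 //; last by exact: lt_le_trans p1.
apply: le_trans (expR_ge1Dx _).
rewrite ler_pdivrMr //; nra.
Qed.

Lemma ln_ge1 (R : realType) (n : nat) : (4 <= n)%N -> 1 <= ln n%:R :> R.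
Proof.
move=> n4; apply: (@le_trans _ _ (ln 4)).
  have -> : 4 = 2 ^+ 2 :> R by ring.
  by have l2 := @ln2_ge_half R; rewrite lnXn // mulr2n; lra.
by rewrite ler_ln ?posrE ?ltr0n ?ler_nat // (leq_trans _ n4).
Qed.

(** Rounding up costs at most 1, so the left side is at most ln n / ln 2 + 1 <= 2 ln n + 1, and ln n
    >= 1. *)
Lemma up_log_le_ln (R : realType) (n : nat) : (4 <= n)%N ->
  (up_log 2 n)%:R <= 3 * ln n%:R :> R.
Proof.
move=> n4.
have n1 : (1 < n)%N by exact: leq_trans n4.
have /andP[h _] := @up_log_bounds 2 n isT n1.
have l2 := @ln2_ge_half R.
have n0 : (0 : R) < n%:R by rewrite ltr0n (leq_trans _ n4).
have hl : (up_log 2 n).-1%:R * ln 2 <= ln n%:R :> R.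
  rewrite mulr_natl -lnXn // ler_ln ?posrE ?exprn_gt0 //.
  by rewrite -natrX ler_nat ltnW.
have h4 := @ln_ge1 R _ n4.
have hm : (up_log 2 n)%:R <= (up_log 2 n).-1%:R + 1 :> R.
  by rewrite natr1 ler_nat leqSpred.
have m0 : 0 <= (up_log 2 n).-1%:R :> R by exact: ler0n.
move: (up_log 2 n)%:R (_.-1%:R) (ln n%:R) (ln 2) l2 hl h4 hm m0 => a b l t.
by move=> *; nra.
Qed.

(** The numerical constants are absorbed by one factor [c], giving the bound c E l; then each factor
    is compared with its own power. *)
Lemma sketch_size_le (R : realType) (p c E l : R) (k L : nat) :
  1 <= p -> 80 * 80 <= c -> 1 <= l -> 1 <= E ->
  E <= (2 `^ (p / c)) `^ (80 * 80) -> k%:R <= 4 * 100 * E + 1 -> L%:R <= 3 * l ->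
  (k * L).+1%:R <= (c * p * 2 `^ (p / c) * l) `^ (80 * 80).
Proof.
move=> p1 c1 l1 E1 EC kE Ll.
have C1 : 1 <= 80 * 80 :> R by rewrite -natrM ler1n.
have c0 : 1 <= c by exact: le_trans c1.
have h1 : (k * L).+1%:R <= c * E * l.
  rewrite -natr1 natrM.
  have h : k%:R * L%:R <= (4 * 100 * E + 1) * (3 * l) by exact: ler_pM.
  apply: (le_trans (lerD h (lexx 1))).
  have El : 1 <= E * l by rewrite -[1]mulr1 ler_pM.
  have lEl : l <= E * l by rewrite -[leLHS]mul1r ler_wpM2r // (le_trans _ l1).
  rewrite -[leRHS]mulrA; have := ler_wpM2r (le_trans ler01 El) c1.
  have -> : (4 * 100 * E + 1) * (3 * l) + 1 = 12 * 100 * (E * l) + 3 * l + 1.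
    by ring.
  by move: (E * l) El lEl => Q; lra.
apply: (le_trans h1).
rewrite !powRM ?mulr_ge0 ?powR_ge0 ?(le_trans ler01) //.
apply: ler_pM; rewrite ?mulr_ge0 ?(le_trans ler01) //; last exact: le1r_powR.
apply: ler_pM; rewrite ?(le_trans ler01) //.
rewrite -[leLHS]mulr1; apply: ler_pM; rewrite ?(le_trans ler01) //.
  exact: le1r_powR.
by apply: le_trans (le1r_powR p1 C1).
Qed.

Lemma lp_small_sketch (R : realType) (p c : R) (d Delta : nat)
    (mu : {ffun 'I_d -> 'I_Delta} -> R) :
  1 <= p -> 80 * 80 <= c -> (2 <= d)%N -> (2 <= Delta)%N ->
  (forall x, 0 <= mu x) -> \sum_x mu x = 1 ->
  exists (s : nat) (Y : finType),
  [/\ (#|Y| <= 2 ^ s)%N,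
      finite_sketch Y (fun x y : {ffun 'I_d -> 'I_Delta} =>
        pnorm p (fun i => (x i : nat)%:R - (y i : nat)%:R)) mu c &
      s%:R <= (c * p * 2 `^ (p / c) * ln (d * Delta)%:R) `^ (80 * 80)].
Proof.
move=> p1 c1 d2 D2 mu0 mu1.
have c0 : 0 < c by apply: lt_le_trans c1; rewrite mulr_gt0 // ltr0n.
have p0 : 0 < p by exact: lt_le_trans p1.
(* The lower bound 6400 on [c] is what makes delta <= 1/8. *)
pose delta := 8 * 100 / c.
have cd : c * delta = 8 * 100 by rewrite /delta mulrC divfK // gt_eqF.
have d0 : 0 < delta by rewrite divr_gt0 // mulr_gt0 // ltr0n.
have d8 : delta <= 8^-1.
  by rewrite ler_pdivrMr // ler_pdivlMl // mulrA; apply: le_trans c1; lra.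
have [E EE] : exists E, E = expR (4 * delta * p) by eexists.
have E1 : 1 <= E.
  rewrite EE; apply: le_trans (expR_ge1Dx _); rewrite lerDl.
  by apply: mulr_ge0; [apply: mulr_ge0; [exact: ler0n | exact: ltW] | exact: ltW].
pose k := (Num.truncn (4 * 100 * E)).+1.
have kgt : 4 * 100 * E < k%:R by exact: truncnS_gt.
have kle : k%:R <= 4 * 100 * E + 1.
  have -> : k%:R = (Num.truncn (4 * 100 * E))%:R + 1 :> R by rewrite natr1.
  rewrite lerD2r truncn_le.
  by apply: mulr_ge0; [apply: mulr_ge0; exact: ler0n | exact: le_trans E1].
have n4 : (4 <= d * Delta)%N by exact: (leq_mul d2 D2).
have l1 := @ln_ge1 R _ n4.
(* E = exp (3200 p / c), and ln 2 >= 1/2 turns this into the exponent 6400 in base 2. *)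
have EC : E <= (2 `^ (p / c)) `^ (80 * 80).
  rewrite -powRrM -[X in X `^ _]lnK ?posrE // -expRM EE ler_expR.
  have -> : 4 * delta * p = 32 * 100 * (p / c) by rewrite /delta; ring.
  have q0 : 0 <= p / c by rewrite divr_ge0 // ltW.
  rewrite [leRHS]mulrCA [leRHS]mulrC; apply: ler_wpM2r => //.
  by have l2 := @ln2_ge_half R; lra.
pose L := up_log 2 (d * Delta).
have size s : (s <= (k * L).+1)%N ->
    s%:R <= (c * p * 2 `^ (p / c) * ln (d * Delta)%:R) `^ (80 * 80).
  move=> sle; apply: (@le_trans _ _ (k * L).+1%:R); first by rewrite ler_nat.
  by apply: (sketch_size_le p1 c1 l1 E1 EC kle); exact: up_log_le_ln.
case: (@lp_finite_sketch R d Delta mu p c delta k p1 d0 d8 cd _ _ mu0 mu1).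
- by apply: le_trans c1; lra.
- apply: ltW; apply: le_lt_trans kgt; rewrite EE; apply: ler_wpM2l.
    by apply: mulr_ge0; exact: ler0n.
  exact: ratio_powR_le.
- move=> fs; exists 2, (bool * bool)%type; split => //.
    by rewrite card_prod !card_bool.
  by apply: size; rewrite ltnS muln_gt0 up_log_gt0 (leq_trans _ n4).
(* One extra bit makes room for the failure message; each of the [k] recorded pairs of coordinate
   and value takes [L] bits. *)
move=> [z fs]; exists (k * L).+1; eexists; split; [|exact: fs|exact: size].
rewrite card_option expnS mul2n -addnn -addn1 addnC leq_add ?expn_gt0 //.
apply: (leq_trans (card_sparse_le z k _)); first by rewrite card_ord (leq_trans _ d2).
by rewrite !card_ord [(k * L)%N]mulnC expnM leq_exp2r // up_logP.
Qed.

Theorem theorem1 :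
  exists c0 C : R, 1 <= c0 /\ 1 <= C /\
  forall (p c : R) (d Delta : nat) (mu : grid d Delta -> R),
    1 <= p -> c0 <= c -> leq 2 d -> leq 2 Delta ->
    is_prob_distr mu ->
    exists (s : nat) (dm : measure_display) (Omega : measurableType dm)
           (P : probability Omega R)
           (sk : Omega -> grid d Delta -> bits s)
           (Alg : Omega -> bits s -> bits s -> R),
      is_avg_distortion_sketch (lp_dist p (d:=d) (Delta:=Delta)) mu c P sk Alg /\
      (s%:R <= powR (c * p * powR 2 (p / c) * ln ((muln d Delta)%:R)) C).
Proof.
exists (80 * 80), (80 * 80).
have C1 : 1 <= 80 * 80 :> R by rewrite -natrM ler1n.
do 2 split => //; move=> p c d Delta mu p1 c1 d2 D2 [mu0 mu1].
have [s [Y [cY fs sle]]] := lp_small_sketch p1 c1 d2 D2 mu0 mu1.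
have [dm [Om [P [sk [Alg h]]]]] := avg_distortion_sketch_of_finite cY fs.
exists s, dm, Om, P, sk, Alg; split => //.
(* Once unlocked, [pnorm] of the difference is [lp_dist] by conversion. *)
by move: h; rewrite pnorm.unlock.
Qed.
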